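(* Let $X_1,X_2,X_3,X_4$ be well-pointed spaces, $m_1,m_2,m_3$ non-negative integers, and $f_i:\Sigma^{m_i}X_i\to X_{i+1}$ $(i=1,2,3)$ pointed maps. Then $$\{f_3,f_2,f_1\}^{(\ddot s_t)}_{(m_3,m_2,m_1)}=\{f_3,f_2,f_1\}^{(aq\ddot s_2)}_{(m_3,m_2,m_1)}=\{f_3,f_2,\Sigma^{m_2}f_1\}_{m_3},$$ where the last bracket is the classical Toda bracket.
   Context: Conventions. All spaces are well-pointed (the inclusion of the base point is a free cofibration); maps and homotopies are pointed; $[X,Y]$ is the set of homotopy classes. $I=[0,1]$ has base point $1$; $S^1=I/\{0,1\}$ with $\bar t$ the class of $t$; $S^k=S^1\wedge\dots\wedge S^1$; $\Sigma^kX=X\wedge S^k$, $CX=X\wedge I$. $Y\cup_fCX$ is the mapping cone of $f:X\to Y$ ($x\wedge0$ identified with $f(x)$), $i_f:Y\to Y\cup_fCX$ the inclusion, and $q'_f:(Y\cup_fCX)\cup_{i_f}CY\to\Sigma X$ collapses $CY$ and sends $x\wedge t$ to $x\wedge\bar t$. For $j:A\to B$, $h:B\to Y$, $h\cup C1_A:B\cup_jCA\to Y\cup_{hj}CA$ is the induced map. $\tau$ is the switch of smash factors; $\psi^\ell_f:\Sigma^\ell Y\cup_{\Sigma^\ell f}C\Sigma^\ell X\to\Sigma^\ell(Y\cup_fCX)$ is $x\wedge s\wedge t\mapsto x\wedge t\wedge s$. $\Sigma^{m_{[k,\ell]}}=\Sigma^{m_k}\cdots\Sigma^{m_\ell}$.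 $\omega^{-1}$ denotes a homotopy inverse. The brackets on the left (3-fold case). Put $C_{2,2}=X_2\cup_{f_1}C\Sigma^{m_1}X_1$, $j_{2,1}=i_{f_1}$. Let $\overline{f_2}:\Sigma^{m_2}C_{2,2}\to X_3$ be an extension of $f_2$ (i.e. $\overline{f_2}\circ\Sigma^{m_2}j_{2,1}=f_2$). Put $C_{3,1}=X_3$, $C_{3,2}=X_3\cup_{f_2}C\Sigma^{m_2}X_2$, $C_{3,3}=X_3\cup_{\overline{f_2}}C\Sigma^{m_2}C_{2,2}$, $j_{3,1}=i_{f_2}$, $j_{3,2}=1_{X_3}\cup C\Sigma^{m_2}j_{2,1}$, $g_{3,1}=f_2$. Let $\widetilde\Sigma^{m_2}\omega_{2,1}=(1_{\Sigma^{m_1}X_1}\wedge\tau(S^1,S^{m_2}))\circ\Sigma^{m_2}q'_{f_1}\circ\psi^{m_2}_{j_{2,1}}:\Sigma^{m_2}C_{2,2}\cup C\Sigma^{m_2}X_2\to\Sigma\Sigma^{m_{[2,1]}}X_1$ and $g_{3,2}=(\overline{f_2}\cup C1_{\Sigma^{m_2}X_2})\circ(\widetilde\Sigma^{m_2}\omega_{2,1})^{-1}:\Sigma\Sigma^{m_{[2,1]}}X_1\to C_{3,2}$. Let $\overline{f_3}:\Sigma^{m_3}C_{3,2}\to X_4$ be an extension of $f_3$. An $aq\ddot s_2$-presentation of $(f_3,f_2,f_1)$ consists of such data $\overline{f_2},\overline{f_3}$ (together with the reduced quasi-structure $\Omega_2=\{q'_{f_1}\}$ and the quasi-structure $\Omega_3$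 on the system $(C_{3,s},g_{3,s},j_{3,s})$ that $\Omega_2$ determines: $\omega_{3,1}=q'_{f_2}$ and $\omega_{3,2}$ the composite of the canonical homeomorphism $C_{3,3}\cup CC_{3,2}\approx(X_3\cup CX_3)\cup C(\Sigma^{m_2}C_{2,2}\cup C\Sigma^{m_2}X_2)$, the quotient map onto $\Sigma(\Sigma^{m_2}C_{2,2}\cup C\Sigma^{m_2}X_2)$, and $\Sigma\widetilde\Sigma^{m_2}\omega_{2,1}$). An $\ddot s_t$-presentation consists of such data $\overline{f_2},\overline{f_3}$ together with the structure $\mathscr A_2=\{1_{C_{2,2}}\}$ and a reduced structure $\mathscr A_3=\{a_{3,1}=1_{C_{3,2}},a_{3,2}\}$, where $a_{3,2}:C_{3,3}\to C_{3,2}\cup_{g_{3,2}}C\Sigma\Sigma^{m_{[2,1]}}X_1$ is a homotopy equivalence with $a_{3,2}\circ j_{3,2}=i_{g_{3,2}}$. For $\star=aq\ddot s_2,\ddot s_t$, $\{f_3,f_2,f_1\}^{(\star)}_{(m_3,m_2,m_1)}\subset[\Sigma\Sigma^{m_{[3,1]}}X_1,X_4]$ is the set of homotopy classes of $\overline{f_3}\circ\Sigma^{m_3}g_{3,2}\circ(1_{\Sigma^{m_{[2,1]}}X_1}\wedge\tau(S^{m_3},S^1))$ for all $\star$-presentations. Classical bracket. For maps $X\xrightarrow{g}Y\xrightarrow{f}Z$ with a null homotopy $A:f\circ g\simeq *$ ($A_0=f\circ g$, $A_1=*$), $[f,A,g]:Y\cup_gCX\to Z$ is the extension of $f$ with $x\wedge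 t\mapsto A(x,t)$, and $(f,A,g):\Sigma X\to Z\cup_fCY$ is the coextension $x\wedge\bar t\mapsto g(x)\wedge(1-2t)$ for $t\le\frac12$, $x\wedge\bar t\mapsto A(x,2t-1)$ for $t\ge\frac12$. $\widetilde\Sigma^mA$ is the null homotopy $(x\wedge s,t)\mapsto A(x,t)\wedge s$. For $h_1:Y_1\to Y_2$, $h_2:Y_2\to Y_3$, $h_3:\Sigma^mY_3\to Y_4$, $\{h_3,h_2,h_1\}_m\subset[\Sigma\Sigma^mY_1,Y_4]$ is the set of classes of $[h_3,A_2,\Sigma^mh_2]\circ(\Sigma^mh_2,\widetilde\Sigma^mA_1,\Sigma^mh_1)$ over all $A_2:h_3\circ\Sigma^mh_2\simeq*$, $A_1:h_2\circ h_1\simeq*$. Here it is applied with $h_1=\Sigma^{m_2}f_1$, $h_2=f_2$, $h_3=f_3$, $m=m_3$. *)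

(* Defs.v *)
From HB Require Import structures.
From Stdlib Require Import Relations.
From mathcomp Require Import all_boot all_order all_algebra generic_quotient.
From mathcomp Require Import all_classical all_reals topology normedtype.

Set Implicit Arguments.
Unset Strict Implicit.
Unset Printing Implicit Defensive.

Import Order.TTheory GRing.Theory Num.Theory.
Import numFieldNormedType.Exports.

Local Open Scope classical_set_scope.
Local Open Scope ring_scope.
Local Open Scope quotient_scope.

(* Disjoint union of topological spaces, pointed by the left summand. *)
Section SumTopology.
Context {X Y : topologicalType}.

Definition sum_open (U : set (X + Y)) : Prop :=
  open (inl @^-1` U) /\ open (inr @^-1` U).

Fact sum_openT : sum_open setT.
Proof. by split; rewrite preimage_setT; exact: openT. Qed.

Fact sum_openI : setI_closed sum_open.
Proof. by move=> A B [? ?] [? ?]; split; rewrite preimage_setI; exact: openI. Qed.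

Fact sum_open_bigcup (I : Type) (F : I -> set (X + Y)) :
  (forall i, sum_open (F i)) -> sum_open (\bigcup_i F i).
Proof.
move=> oF; split; rewrite preimage_bigcup; apply: bigcup_open => i _;
  by case: (oF i).
Qed.

HB.instance Definition _ :=
  isOpenTopological.Build (X + Y)%type sum_openT sum_openI sum_open_bigcup.
End SumTopology.

HB.instance Definition _ (X : ptopologicalType) (Y : topologicalType) :=
  isPointed.Build (X + Y)%type (inl point).

HB.instance Definition _ (X Y : ptopologicalType) := Pointed.on (X * Y)%type.

(* The quotient of T by the equivalence relation generated by e. *)
Section GeneratedQuotient.
Context (T : ptopologicalType) (e : T -> T -> Prop).

Definition gen_equiv (x y : T) : bool := `[< clos_refl_sym_trans T e x y >].

Fact gen_equiv_refl : reflexive gen_equiv.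
Proof. by move=> x; apply/asboolP; exact: rst_refl. Qed.

Fact gen_equiv_sym : symmetric gen_equiv.
Proof. by move=> x y; apply/asboolP/asboolP; exact: rst_sym. Qed.

Fact gen_equiv_trans : transitive gen_equiv.
Proof.
by move=> y x z /asboolP xy /asboolP yz; apply/asboolP; exact: rst_trans yz.
Qed.

Canonical gen_equiv_rel :=
  EquivRel gen_equiv gen_equiv_refl gen_equiv_sym gen_equiv_trans.

Definition gquot : ptopologicalType :=
  quotient_topology {eq_quot gen_equiv_rel}.

Definition gclass (x : T) : gquot := \pi_(gquot) x.

(* The map induced on the quotient by f; it is the intended map only when f is
   compatible with e, see gquot_recE. *)
Definition gquot_rec (Z : Type) (f : T -> Z) (q : gquot) : Z := f (repr q).

Lemma gclass_eq (x y : T) : e x y -> gclass x = gclass y.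
Proof. by move=> exy; apply/eqmodP/asboolP; exact: rst_step. Qed.

Lemma gquot_recE (Z : Type) (f : T -> Z) (x : T) :
  (forall a b, e a b -> f a = f b) -> gquot_rec f (gclass x) = f x.
Proof.
move=> ef.
have efE a b : clos_refl_sym_trans T e a b -> f a = f b.
  by elim=> [c d /ef||c d _ ->|c d u _ -> _ ->].
have /eqmodP/asboolP/efE // : gclass (repr (gclass x)) = gclass x.
by rewrite /gclass reprK.
Qed.

Lemma gquot_rec_continuous (Z : topologicalType) (f : T -> Z) :
  (forall a b, e a b -> f a = f b) -> continuous f -> continuous (gquot_rec f).
Proof.
move=> ef cf; apply/quotient_continuous.
have -> // : gquot_rec f \o \pi_(gquot) = f.
by apply/funext => x; exact: (gquot_recE x ef).
Qed.
End GeneratedQuotient.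

Unset Implicit Arguments.

Section TodaBrackets.
Context (R : realType).

Definition unitI : Type := `[0%R, 1%R]%classic : set R.
HB.instance Definition _ := Topological.on unitI.

Fact toI_subproof (r : R) :
  Num.max 0 (Num.min 1 r) \in (`[0%R, 1%R]%classic : set R).
Proof.
apply/mem_set => /=.
by rewrite in_itv /= le_max lexx /= ge_max ler01 ge_min lexx.
Qed.

(* The point r of I, for 0 <= r <= 1 (other values of r are clamped). *)
Definition toI (r : R) : unitI := SigSub (toI_subproof r).

HB.instance Definition _ := isPointed.Build unitI (toI 1).

Definition circle : ptopologicalType :=
  @gquot unitI (fun s t => s = toI 0 /\ t = toI 1).

Definition tbar (t : unitI) : circle := gclass _ t.

(* All the maps below are defined on quotients through representatives and are
   not bundled with continuity; homotopic is what forces it. *)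
Definition smash (X Y : ptopologicalType) : ptopologicalType :=
  @gquot (X * Y)%type
    (fun p q => (p.1 = point \/ p.2 = point) /\ q = (point, point)).

Definition smash_pair {X Y : ptopologicalType} (x : X) (y : Y) : smash X Y :=
  gclass _ (x, y).
Local Notation "x ∧ y" := (smash_pair x y) (at level 40, left associativity).

Definition smash_rec {X Y : ptopologicalType} {Z : Type} (f : X -> Y -> Z) :
  smash X Y -> Z := gquot_rec (fun p => f p.1 p.2).

Lemma smash_recE {X Y : ptopologicalType} {Z : Type} (f : X -> Y -> Z) (z : Z) :
  (forall y, f point y = z) -> (forall x, f x point = z) ->
  forall x y, smash_rec f (x ∧ y) = f x y.
Proof.
move=> fl fr x y; rewrite /smash_rec gquot_recE //=.
by move=> [a b] [c d] /= [ab [-> ->]]; case: ab => ->; rewrite ?fl ?fr.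
Qed.

(* S^0 is the two-point space, so that susp 0 X is canonically X. *)
Fixpoint sphere (k : nat) : ptopologicalType :=
  match k with
  | 0 => bool
  | k'.+1 => if k' is 0 then circle else smash (sphere k') circle
  end.

Definition susp (k : nat) (X : ptopologicalType) : ptopologicalType :=
  smash X (sphere k).

Definition cone (X : ptopologicalType) : ptopologicalType := smash X unitI.

Definition smap (k : nat) {X Y : ptopologicalType} (f : X -> Y) :
  susp k X -> susp k Y := smash_rec (fun x s => f x ∧ s).

(* The map 1_Z ∧ τ(A, B), with the associativity of ∧ left implicit. *)
Definition switch {Z A B : ptopologicalType} :
    smash (smash Z A) B -> smash (smash Z B) A :=
  smash_rec (fun u b => smash_rec (fun z a => z ∧ b ∧ a) u).

Definition mapcone {X Y : ptopologicalType} (f : X -> Y) : ptopologicalType :=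
  @gquot (Y + cone X)%type
    (fun p q => exists x, p = inr (x ∧ toI 0) /\ q = inl (f x)).

Definition cone_base {X Y : ptopologicalType} (f : X -> Y) (y : Y) :
  mapcone f := gclass _ (inl y).

Definition cone_pt {X Y : ptopologicalType} (f : X -> Y) (x : X) (t : unitI) :
  mapcone f := gclass _ (inr (x ∧ t)).

Definition mapcone_rec {X Y : ptopologicalType} {f : X -> Y} {Z : Type}
    (b : Y -> Z) (c : X -> unitI -> Z) : mapcone f -> Z :=
  gquot_rec (fun p => match p with inl y => b y | inr z => smash_rec c z end).

Lemma mapcone_recE {X Y : ptopologicalType} (f : X -> Y) {Z : Type}
    (b : Y -> Z) (c : X -> unitI -> Z) :
  (forall t, c point t = b point) -> (forall x, c x point = b point) ->
  (forall x, c x (toI 0) = b (f x)) ->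
  (forall y, mapcone_rec b c (cone_base f y) = b y) /\
  (forall x t, mapcone_rec b c (cone_pt f x t) = c x t).
Proof.
move=> cl cr c0; have cE := smash_recE c (b point) cl cr.
have compat p q : (exists x, p = inr (x ∧ toI 0) /\ q = inl (f x)) ->
    match p with inl y => b y | inr z => smash_rec c z end =
    match q with inl y => b y | inr z => smash_rec c z end.
  by move=> [x [-> ->]]; rewrite cE.
by split=> *; rewrite /mapcone_rec gquot_recE //= cE.
Qed.

(* h ∪ Ck, for h \o f = f' \o k *)
Definition mapcone_map {X Y X' Y' : ptopologicalType} {f : X -> Y}
    {f' : X' -> Y'} (h : Y -> Y') (k : X -> X') : mapcone f -> mapcone f' :=
  mapcone_rec (fun y => cone_base f' (h y)) (fun x t => cone_pt f' (k x) t).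

Definition pinch {X Y : ptopologicalType} {f : X -> Y} :
    mapcone f -> susp 1 X :=
  mapcone_rec (fun _ => point) (fun x t => x ∧ tbar t).

Definition qprime {X Y : ptopologicalType} (f : X -> Y) :
    mapcone (cone_base f) -> susp 1 X :=
  mapcone_rec pinch (fun _ _ => point).

Definition psi (l : nat) {X Y : ptopologicalType} (f : X -> Y) :
    mapcone (smap l f) -> susp l (mapcone f) :=
  mapcone_rec
    (smash_rec (fun y s => cone_base f y ∧ s))
    (fun u t => smash_rec (fun x s => cone_pt f x t ∧ s) u).

Definition pointed_map {X Y : ptopologicalType} (f : X -> Y) : Prop :=
  continuous f /\ f point = point.

Definition pointed_homotopy {X Y : ptopologicalType} (f g : X -> Y)
    (H : X * unitI -> Y) : Prop :=
  [/\ continuous H, forall x, H (x, toI 0) = f x,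
      forall x, H (x, toI 1) = g x & forall t, H (point, t) = point].

Definition homotopic {X Y : ptopologicalType} (f g : X -> Y) : Prop :=
  exists H, pointed_homotopy f g H.

(* The homotopy class of a pointed map f, an element of [X, Y]; any g that is
   homotopic to f is automatically a pointed map. *)
Definition hclass {X Y : ptopologicalType} (f : X -> Y) : set (X -> Y) :=
  [set g | homotopic f g].

Definition homotopy_inverse {X Y : ptopologicalType} (f : X -> Y)
    (g : Y -> X) : Prop :=
  [/\ pointed_map g, homotopic (g \o f) idfun & homotopic (f \o g) idfun].

Definition homotopy_equivalence {X Y : ptopologicalType} (f : X -> Y) : Prop :=
  pointed_map f /\ exists g, homotopy_inverse f g.

Definition well_pointed (X : ptopologicalType) : Prop :=
  forall (Z : topologicalType) (f : X -> Z) (h : unitI -> Z),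
    continuous f -> continuous h -> h (toI 0) = f point ->
    exists H : X * unitI -> Z,
      [/\ continuous H, forall x, H (x, toI 0) = f x &
          forall t, H (point, t) = h t].

Section Classical.
Context {X Y Z : ptopologicalType}.

Definition null_homotopy (f : X -> Y) (A : X * unitI -> Y) : Prop :=
  pointed_homotopy f (fun _ => point) A.

(* [f, A, g] *)
Definition extension (f : Y -> Z) (A : X * unitI -> Z) (g : X -> Y) :
    mapcone g -> Z :=
  mapcone_rec f (fun x t => A (x, t)).

(* (f, A, g) *)
Definition coextension (f : Y -> Z) (A : X * unitI -> Z) (g : X -> Y) :
    susp 1 X -> mapcone f :=
  smash_rec (fun x => gquot_rec (fun t : unitI =>
    let r := set_val t : R in
    if r <= 2^-1 then cone_pt f (g x) (toI (1 - 2 * r))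
    else cone_base f (A (x, toI (2 * r - 1))))).

Definition susp_homotopy (m : nat) (A : X * unitI -> Y) :
    susp m X * unitI -> susp m Y :=
  fun p => smash_rec (fun x s => A (x, p.2) ∧ s) p.1.
End Classical.

(* {h3, h2, h1}_m *)
Definition toda_bracket (m : nat) {Y1 Y2 Y3 Y4 : ptopologicalType}
    (h3 : susp m Y3 -> Y4) (h2 : Y2 -> Y3) (h1 : Y1 -> Y2) :
    set (set (susp 1 (susp m Y1) -> Y4)) :=
  [set c | exists A2 A1,
    [/\ null_homotopy (h3 \o smap m h2) A2, null_homotopy (h2 \o h1) A1 &
      c = hclass (extension h3 A2 (smap m h2) \o
            coextension (smap m h2) (susp_homotopy m A1) (smap m h1))]].

(* For w = ω : B ∪_j CA -> ΣZ, the map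
   Σ~^m ω : Σ^m B ∪ CΣ^m A -> ΣΣ^m Z. *)
Definition susp_omega (m : nat) {A B Z : ptopologicalType} {j : A -> B}
    (w : mapcone j -> susp 1 Z) : mapcone (smap m j) -> susp 1 (susp m Z) :=
  switch \o smap m w \o psi m j.

(* For j : A -> B and h : B -> Y extending f : A -> Y, the homeomorphism
   (Y ∪_h CB) ∪ C(Y ∪_f CA) ≈ (Y ∪ CY) ∪ C(B ∪_j CA), where B ∪_j CA is
   attached by h ∪ Cf; on double cones it exchanges the two parameters. *)
Definition cone_exchange {A B Y : ptopologicalType} (j : A -> B) (h : B -> Y)
    (f : A -> Y) :
    mapcone (mapcone_map idfun j : mapcone f -> mapcone h) ->
    mapcone (mapcone_map h f : mapcone j -> mapcone (@idfun Y)) :=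
  let F : mapcone j -> mapcone (@idfun Y) := mapcone_map h f in
  mapcone_rec
    (mapcone_rec (fun y => cone_base F (cone_base idfun y))
                 (fun b t => cone_pt F (cone_base j b) t))
    (fun c t => mapcone_rec
                 (fun y => cone_base F (cone_pt idfun y t))
                 (fun a s => cone_pt F (cone_pt j a t) s) c).

Section Presentations.
Context {X1 X2 X3 X4 : ptopologicalType} {m1 m2 m3 : nat}.
Context (f3 : susp m3 X3 -> X4) (f2 : susp m2 X2 -> X3) (f1 : susp m1 X1 -> X2).

Definition C22 : ptopologicalType := mapcone f1.
Definition j21 : X2 -> C22 := cone_base f1.
Definition C32 : ptopologicalType := mapcone f2.
Definition j31 : X3 -> C32 := cone_base f2.
Definition C33 (f2bar : susp m2 C22 -> X3) : ptopologicalType := mapcone f2bar.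
Definition j32 (f2bar : susp m2 C22 -> X3) : C32 -> C33 f2bar :=
  mapcone_map idfun (smap m2 j21).

Definition omega21 : mapcone j21 -> susp 1 (susp m1 X1) := qprime f1.
Definition susp_omega21 :
  mapcone (smap m2 j21) -> susp 1 (susp m2 (susp m1 X1)) :=
  susp_omega m2 omega21.

(* The data common to both kinds of presentations, including the choice of a
   homotopy inverse used to define g_{3,2}. *)
Record bracket_data := {
  f2bar : susp m2 C22 -> X3;
  f2bar_map : pointed_map f2bar;
  f2barE : f2bar \o smap m2 j21 = f2;
  susp_omega21_inv : susp 1 (susp m2 (susp m1 X1)) -> mapcone (smap m2 j21);
  susp_omega21_invP : homotopy_inverse susp_omega21 susp_omega21_inv;
  f3bar : susp m3 C32 -> X4;
  f3bar_map : pointed_map f3bar;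
  f3barE : f3bar \o smap m3 j31 = f3
}.

Definition g32 (d : bracket_data) : susp 1 (susp m2 (susp m1 X1)) -> C32 :=
  mapcone_map (f2bar d) idfun \o susp_omega21_inv d.

Definition bracket_map (d : bracket_data) :
    susp 1 (susp m3 (susp m2 (susp m1 X1))) -> X4 :=
  f3bar d \o smap m3 (g32 d) \o switch.

Definition omega31 : mapcone j31 -> susp 1 (susp m2 X2) := qprime f2.

Definition omega32 (d : bracket_data) :
    mapcone (j32 (f2bar d)) -> susp 1 (susp 1 (susp m2 (susp m1 X1))) :=
  smap 1 susp_omega21 \o pinch \o
  cone_exchange (smap m2 j21) (f2bar d) f2.

(* The maps of a quasi-structure are homotopy equivalences; here they are all
   determined by f1, f2 and f2bar, so only that property appears. *)
Record aqs2_presentation := {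
  aqs2_data : bracket_data;
  aqs2_Omega2 : homotopy_equivalence omega21;
  aqs2_Omega31 : homotopy_equivalence omega31;
  aqs2_Omega32 : homotopy_equivalence (omega32 aqs2_data)
}.

(* The maps a_{2,1} and a_{3,1} of a reduced structure are the identities of
   C22 and C32, so only a_{3,2} appears. *)
Record st_presentation := {
  st_data : bracket_data;
  a32 : C33 (f2bar st_data) -> mapcone (g32 st_data);
  a32_equiv : homotopy_equivalence a32;
  a32E : a32 \o j32 (f2bar st_data) = cone_base (g32 st_data)
}.

Definition aqs2_bracket :
    set (set (susp 1 (susp m3 (susp m2 (susp m1 X1))) -> X4)) :=
  [set hclass (bracket_map (aqs2_data p)) | p in [set: aqs2_presentation]].

Definition st_bracket :
    set (set (susp 1 (susp m3 (susp m2 (susp m1 X1))) -> X4)) :=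
  [set hclass (bracket_map (st_data p)) | p in [set: st_presentation]].
End Presentations.
End TodaBrackets.

(* Main.v *)
(* Up to homotopy, a presentation carries no more than the two extensions of [f2]
   and [f3]: the omegas are always homotopy equivalences, and replacing the chosen
   inverse of the suspended [omega_{2,1}] does not change the class of the bracket
   map.  For the inverse given by the coextension of [f1], the map [g_{3,2}] is on
   the nose the coextension of [f2] along the null homotopy encoded by the
   extension of [f2], so the bracket map is literally Toda's composite; and the
   required [a_{3,2}] comes from a self-equivalence of the square that straightens
   two adjacent edges onto one.  No compactly generated spaces are needed: [I] and
   the spheres have bases of compact neighbourhoods, so taking the product with
   them preserves the quotient maps that define smash products and cones. *)
From Stdlib Require Import Relations.
Require Import Defs.
From mathcomp Require Import all_boot all_order all_algebra lra generic_quotient finmap.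
From mathcomp Require Import all_classical all_reals topology normedtype.

Set Implicit Arguments.
Unset Strict Implicit.
Unset Printing Implicit Defensive.

Import Order.TTheory GRing.Theory Num.Theory.
Import numFieldNormedType.Exports.

Local Open Scope classical_set_scope.
Local Open Scope ring_scope.

(** * Point-set topology of quotients *)

(** The map [a32] must restrict to the inclusion strictly, not just up to homotopy. It is therefore
    given by a formula for one convenient inverse, while all other inverses enter only through
    homotopy classes. The formula comes from a picture. Let [k] extend [l] over the mapping cone of
    [f : X -> A]. Over each [x], the cone on that mapping cone contains a square with coordinates
    [s] (inner cone) and [t] (outer cone). The edge [s = 0] is glued to the cone line over [f x],
    the edge [t = 0] is glued to [Y] by [k], and the other two edges go to the base point. Running
    down [s = 0] and then along [t = 0] traces a loop in the mapping cone of [l], and that loop is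
    the coextension. So attaching the squares amounts to attaching a cone on the suspension of [X],
    once the two edges are straightened into one. Extensions live on suspensions of mapping cones,
    null homotopies on mapping cones of suspensions. As [psi] is a homeomorphism, passing between
    the two loses nothing. *)

Lemma gclassP (T : ptopologicalType) (e : T -> T -> Prop) (x y : T) :
  gclass e x = gclass e y <-> clos_refl_sym_trans T e x y.
Proof. by split=> [/eqmodP/asboolP|h] //; apply/eqmodP/asboolP. Qed.

Lemma gclass_surj (T : ptopologicalType) (e : T -> T -> Prop) (q : gquot e) :
  exists x, q = gclass e x.
Proof. by exists (repr q); rewrite /gclass reprK. Qed.

Lemma gclass_continuous (T : ptopologicalType) (e : T -> T -> Prop) :
  continuous (gclass e).
Proof. exact: pi_continuous. Qed.

Lemma gquot_open (T : ptopologicalType) (e : T -> T -> Prop)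
    (U : set (gquot e)) : open (gclass e @^-1` U) -> open U.
Proof. by []. Qed.

(* Every point has arbitrarily small compact neighbourhoods; no separation is
   assumed, unlike for [locally_compact]. *)
Definition compactly_based (K : topologicalType) : Prop :=
  forall (x : K) (U : set K), nbhs x U ->
    exists C : set K, [/\ nbhs x C, compact C & C `<=` U].

Lemma compactly_based_prod (K L : topologicalType) :
  compactly_based K -> compactly_based L -> compactly_based (K * L)%type.
Proof.
move=> bK bL [x y] U [[A B] /= [nA nB] ABU].
have [C [nC cC CA]] := bK _ _ nA; have [D [nD cD DB]] := bL _ _ nB.
exists (C `*` D); split; [by exists (C, D)|exact: compact_setX|].
by move=> [a b] [/= /CA Aa /DB Bb]; exact: ABU.
Qed.

Lemma tube (T K : topologicalType) (C : set K) (U : set (T * K)) (t : T) :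
  compact C -> (forall k, C k -> nbhs (t, k) U) ->
  \forall t' \near t, forall k, C k -> U (t', k).
Proof.
move=> /compact_near_coveringP cC nU.
apply: (cC T (nbhs t) (fun t' k => U (t', k))) => k Ck.
have [[A B] /= [nA nB] ABU] := nU k Ck.
exists (B, A) => //= -[k' t'] /= [Bk At]; exact: ABU.
Qed.

(** Given a compact neighbourhood [C] of [k], the classes whose slice over [C] is mapped into [W]
    form a set [V]. Its preimage in [T] is open by the tube lemma, so [V] is open in the quotient,
    and [V] times [C] is the wanted neighbourhood. *)
Lemma gquot_prod_continuous (T : ptopologicalType) (e : T -> T -> Prop)
    (K Z : topologicalType) (f : gquot e * K -> Z) :
  compactly_based K -> continuous (fun p : T * K => f (gclass e p.1, p.2)) ->
  continuous f.
Proof.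
move=> bK cf; apply/continuousP => W oW.
have oU : open [set p : T * K | W (f (gclass e p.1, p.2))].
  by move/continuousP: cf => /(_ W oW).
rewrite openE => -[q k] /=; have [t ->] := gclass_surj q => Wtk.
have nk : nbhs k [set k' | W (f (gclass e t, k'))].
  have : nbhs (t, k) [set p : T * K | W (f (gclass e p.1, p.2))].
    exact: open_nbhs_nbhs.
  case=> -[A B] /= [nA nB] AB; apply: filterS nB => k' Bk'.
  by apply: (AB (t, k')); split => //=; exact: nbhs_singleton.
have [C [nC cC CU]] := bK _ _ nk.
pose V : set (gquot e) := [set q | forall k, C k -> W (f (q, k))].
have oV : open V.
  apply: gquot_open; rewrite openE => t' /= Vt'.
  apply: (@tube _ _ C [set p : T * K | W (f (gclass e p.1, p.2))]) => // k' Ck'.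
  by apply: open_nbhs_nbhs; split => //; exact: Vt'.
exists (V, C); first by split=> //; apply: open_nbhs_nbhs; split.
by move=> [q' k'] /= [Vq Ck']; exact: Vq.
Qed.

Lemma gquot_continuous (T : ptopologicalType) (e : T -> T -> Prop)
    (Z : topologicalType) (f : gquot e -> Z) :
  continuous (fun x => f (gclass e x)) -> continuous f.
Proof. by move=> cf; apply/quotient_continuous. Qed.

(** * Collapsing a closed subset of a compact space *)

Section Collapse.
Context (T : ptopologicalType) (e : T -> T -> Prop) (A : set T).
Hypothesis eA : forall x y, gclass e x = gclass e y <-> x = y \/ (A x /\ A y).

Let preim_im (F : set T) :
  gclass e @^-1` (gclass e @` F) = F `|` (if `[< F `&` A !=set0 >] then A else set0).
Proof.
apply/seteqP; split => x /=.
  move=> [y Fy /eA[<-|[Ay Ax]]]; [by left|right].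
  by case: ifP => // /asboolP; apply; exists y.
move=> [Fx|]; first by exists x.
case: ifP => // /asboolP[y [Fy Ay]] Ax; exists y => //.
by apply/eA; right.
Qed.

Hypothesis cA : closed A.

(** The saturation of [F] is either [F] or the union of [F] and [A], both closed. *)
Lemma collapse_closed (F : set T) : closed F -> closed (gclass e @` F).
Proof.
move=> cF; rewrite -[X in closed X]setCK; apply: open_closedC; apply: gquot_open.
rewrite preimage_setC; apply: closed_openC.
rewrite -[X in closed X]/(gclass e @^-1` (gclass e @` F)) preim_im.
by apply: closedU => //; case: ifP => // _; exact: closed0.
Qed.

Lemma collapse_closed_pt (a : T) : A a -> closed [set gclass e a].
Proof.
move=> Aa; suff -> : [set gclass e a] = gclass e @` A by exact: collapse_closed.
apply/seteqP; split => q /=; first by move=> ->; exists a.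
by move=> [b Ab <-]; apply/eA; right.
Qed.

Hypothesis cT : compact [set: T].

Lemma collapse_compact : compact [set: gquot e].
Proof.
have -> : [set: gquot e] = gclass e @` [set: T].
  by apply/seteqP; split => // q _; have [x ->] := gclass_surj q; exists x.
apply: continuous_compact => //; apply: continuous_subspaceT.
exact: gclass_continuous.
Qed.

Hypothesis bT : compactly_based T.

(** A fibre is a point or all of [A], hence compact, so finitely many compact neighbourhoods of its
    points cover it. The image of their union is a neighbourhood of [q] because the quotient map is
    closed. *)
Lemma collapse_nbhs (q : gquot e) (U : set (gquot e)) : nbhs q U ->
  exists D : set T, [/\ compact D, D `<=` gclass e @^-1` U & nbhs q (gclass e @` D)].
Proof.
move=> nU; pose F := [set x | gclass e x = q].
have cF : compact F.
  have [x qx] := gclass_surj q; rewrite /F qx.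
  have [Ax|nAx] := pselect (A x).
    suff -> : [set y | gclass e y = gclass e x] = A.
      by apply: (subclosed_compact cA cT).
    apply/seteqP; split => y /=; first by case/eA=> [->|[]].
    by move=> Ay; apply/eA; right.
  suff -> : [set y | gclass e y = gclass e x] = [set x] by exact: compact_set1.
  apply/seteqP; split => y /=; last by move->.
  by case/eA=> [->|[_ /nAx]].
have nV x : F x -> nbhs x (gclass e @^-1` U).
  by move=> Fx; apply: (@gclass_continuous _ e x); rewrite Fx.
(* A finite union of compact neighbourhoods of points of the fibre [F]. *)
have [D [cD DU FD]] : exists D : set T,
    [/\ compact D, D `<=` gclass e @^-1` U & forall x, F x -> nbhs x D].
  (* Off the fibre [set0] is a dummy value, so that [choice] can be applied over all of [T]. *)
  have h x : exists C, F x ->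
      [/\ nbhs x C, compact C & C `<=` gclass e @^-1` U].
    have [Fx|nFx] := pselect (F x); last by exists set0 => /nFx.
    by have [C hC] := bT (nV x Fx); exists C.
  have [C hC] := choice h.
  have : cover_compact F by rewrite -compact_cover.
  move=> /(_ T F (fun x => (C x)^°)).
  case=> [x Fx|x Fx|s sF cov].
  - exact: open_interior.
  - by exists x => //; have [nC _ _] := hC x Fx; exact: nC.
  exists (\bigcup_(x in [set` s]) C x); split.
  - rewrite bigcup_fset big_seq; apply: bigsetU_compact => x xs.
    by have [] := hC x (set_mem (sF x xs)).
  - move=> y [x /= xs Cxy].
    by have [_ _ sub] := hC x (set_mem (sF x xs)); exact: sub.
  - move=> y Fy; have [x /= xs Cxy] := cov y Fy.
    by apply: filterS Cxy => z Cz; exists x.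
exists D; split=> //.
have oD : open (D^°) by exact: open_interior.
have := collapse_closed (open_closedC oD).
move=> /closed_openC oN.
have : nbhs q (~` (gclass e @` (~` D^°))).
  apply: open_nbhs_nbhs; split => // -[x nDx xq]; apply: nDx; exact: FD.
apply: filterS => r nr; have [x rx] := gclass_surj r; exists x => //.
apply: interior_subset; apply: contrapT => nDx; apply: nr; by exists x.
Qed.

Lemma collapse_compactly_based : compactly_based (gquot e).
Proof.
move=> q U /collapse_nbhs[D [cD DU nD]]; exists (gclass e @` D); split=> //.
  apply: continuous_compact => //; apply: continuous_subspaceT.
  exact: gclass_continuous.
by move=> _ [x Dx <-]; exact: DU.
Qed.

(** The other factor [X] is arbitrary here: compactness comes from the set [D] in [T] lying above a
    neighbourhood of [q], and the tube lemma is applied to [D]. *)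
Lemma collapse_prod_continuous (X Z : topologicalType) (f : X * gquot e -> Z) :
  continuous (fun p : X * T => f (p.1, gclass e p.2)) -> continuous f.
Proof.
move=> cf; apply/continuousP => W oW.
have oU : open [set p : X * T | W (f (p.1, gclass e p.2))].
  by move/continuousP: cf => /(_ W oW).
have nU x t : W (f (x, gclass e t)) ->
    nbhs (x, t) [set p : X * T | W (f (p.1, gclass e p.2))].
  by move=> Wxt; apply: open_nbhs_nbhs; split.
rewrite openE => -[x q] Wxq.
have : nbhs q [set q' | W (f (x, q'))].
  apply: open_nbhs_nbhs; split => //; apply: gquot_open; rewrite openE => t Wxt.
  have [[V V'] [nV nV'] VV'] := nU x t Wxt; apply: filterS nV' => t' Vt'.
  by apply: (VV' (x, t')); split => //=; exact: nbhs_singleton.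
move=> /collapse_nbhs[D [cD DU nD]].
have nx : \forall x' \near x, forall t, D t -> W (f (x', gclass e t)).
  by apply: (@tube _ _ D [set p : X * T | W (f (p.1, gclass e p.2))]) => // t Dt;
    apply: nU; exact: DU.
exists ([set x' | forall t, D t -> W (f (x', gclass e t))], gclass e @` D) => //.
by move=> [x' r] [Dx' [t Dt tr]]; have := Dx' t Dt; rewrite tr.
Qed.
End Collapse.

Lemma rst_collapse (T : Type) (e : T -> T -> Prop) (A : set T) (x y : T) :
  (forall a b, e a b -> A a /\ A b) -> clos_refl_sym_trans T e x y ->
  x = y \/ (A x /\ A y).
Proof.
move=> eA; elim=> [a b /eA|a|a b _ [->|[]]|a b c _ ab _ bc]; [by right|by left|by left|by right|].
by case: ab bc => [->//|[Aa Ab]] [<-|[_ Ac]]; right.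
Qed.

(** * The unit interval and the circle *)

Section Interval.
Context (R : realType).
Local Notation I := (unitI R).

Definition ival (t : I) : R := set_val t.

Lemma ival_ge0 (t : I) : 0 <= ival t.
Proof. by have /set_mem := valP t; rewrite /= in_itv /= => /andP[]. Qed.

Lemma ival_le1 (t : I) : ival t <= 1.
Proof. by have /set_mem := valP t; rewrite /= in_itv /= => /andP[]. Qed.

Lemma ival_toI (r : R) : ival (toI R r) = Num.max 0 (Num.min 1 r).
Proof. by []. Qed.

Lemma toIK (r : R) : 0 <= r <= 1 -> ival (toI R r) = r.
Proof. by move=> /andP[r0 r1]; rewrite ival_toI (min_idPr r1) (max_idPr r0). Qed.

Lemma ivalK (t : I) : toI R (ival t) = t.
Proof. by apply: val_inj; apply: toIK; rewrite ival_ge0 ival_le1. Qed.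

Lemma ival_inj : injective ival.
Proof. by move=> s t e; rewrite -(ivalK s) e ivalK. Qed.

Lemma toI_le0 (r : R) : r <= 0 -> toI R r = toI R 0.
Proof.
move=> r0; apply: ival_inj; rewrite !ival_toI.
by rewrite (min_idPr (le_trans r0 ler01)) (min_idPr ler01) !max_l.
Qed.

Lemma toI_ge1 (r : R) : 1 <= r -> toI R r = toI R 1.
Proof.
by move=> r1; apply: ival_inj; rewrite !ival_toI (min_idPl r1) minxx.
Qed.

Lemma ival0 : ival (toI R 0) = 0.
Proof. by rewrite toIK // lexx ler01. Qed.

Lemma ival1 : ival (toI R 1) = 1.
Proof. by rewrite toIK // lexx ler01. Qed.

Lemma ival_continuous : continuous ival.
Proof. exact: initial_continuous. Qed.

Lemma clamp_continuous : continuous (fun r : R => Num.max 0 (Num.min 1 r)).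
Proof.
move=> r; apply: continuous_max; first exact: cst_continuous.
by apply: continuous_min; [exact: cst_continuous|exact: cvg_id].
Qed.

Lemma toI_continuous : continuous (toI R).
Proof. by apply: continuous_comp_initial; exact: clamp_continuous. Qed.

Lemma unitI_compact : compact [set: I].
Proof.
have -> : [set: I] = toI R @` `[0, 1].
  by apply/seteqP; split => // t _; exists (ival t);
    rewrite ?ivalK //= in_itv /= ival_ge0 ival_le1.
apply: continuous_compact; last exact: segment_compact.
by apply: continuous_subspaceT; exact: toI_continuous.
Qed.

Lemma unitI_closed1 (a : I) : closed [set a].
Proof.
have -> : [set a] = ival @^-1` [set ival a].
  by apply/seteqP; split => t /=; [move=> ->|move=> e; rewrite -(ivalK t) e ivalK].
by move/continuous_closedP: ival_continuous; apply; exact: closed_eq.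
Qed.

Lemma unitI_based : compactly_based I.
Proof.
move=> t U nU.
have [V [[B oB BV] Vt] VU] : exists2 V, open_nbhs t V & V `<=` U by move: nU; rewrite nbhsE.
have : nbhs (ival t) B by apply: open_nbhs_nbhs; split => //; rewrite -BV in Vt.
move=> /nbhs_ballP[e /= e0 eB].
have e2 : 0 < e / 2 by rewrite divr_gt0.
pose C : set R := closed_ball (ival t) (e / 2).
have nC : nbhs (ival t) C.
  by apply/nbhs_ballP; exists (e / 2) => //; exact: subset_closed_ball.
exists (ival @^-1` C); split.
- exact: (@ival_continuous t C nC).
- apply: subclosed_compact unitI_compact _ => //.
  by move/continuous_closedP: ival_continuous; apply; exact: closed_ball_closed.
- move=> s Cs; apply: VU; rewrite -BV; apply: eB.
  by apply: (closed_ball_subset e2 _ Cs); rewrite ltr_pdivrMr // ltr_pMr // ltr1n.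
Qed.

Lemma circle_collapse (s t : I) :
  tbar R s = tbar R t <->
  s = t \/ ([set toI R 0; toI R 1] s /\ [set toI R 0; toI R 1] t).
Proof.
split=> [/gclassP|[->//|]].
  by apply: rst_collapse => a b [-> ->]; split; [left|right].
have e01 : tbar R (toI R 0) = tbar R (toI R 1) by exact: gclass_eq.
by move=> [[->|->] [->|->]].
Qed.

End Interval.

Lemma smash_collapse (X Y : ptopologicalType) (p q : X * Y) :
  let A := [set r : X * Y | r.1 = point \/ r.2 = point] in
  let e := fun p q : X * Y => (p.1 = point \/ p.2 = point) /\ q = (point, point) in
  gclass e p = gclass e q <-> p = q \/ (A p /\ A q).
Proof.
move=> A e; split=> [/gclassP|[->//|[Ap Aq]]].
  by apply: rst_collapse => a b [Aa ->]; split=> //; left.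
have eE r : A r -> gclass e r = gclass e (point, point) by move=> Ar; exact: gclass_eq.
by rewrite !eE.
Qed.

(** * Spheres have bases of compact neighbourhoods *)

Section Sphere.
Context (R : realType).

(** Closedness of the base point is carried along because it makes the axes, which the next smash
    product collapses, a closed set. *)
Lemma smash_based (K L : ptopologicalType) :
  compact [set: K] -> compact [set: L] ->
  compactly_based K -> compactly_based L ->
  closed [set point : K] -> closed [set point : L] ->
  [/\ compact [set: smash K L], compactly_based (smash K L) &
    closed [set point : smash K L]].
Proof.
move=> cK cL bK bL pK pL.
pose A := [set r : K * L | r.1 = point \/ r.2 = point].
have eA := @smash_collapse K L.
have cA : closed A.
  apply: closedU.
    by apply: (@preimage_closed _ _ fst _ _ pK) => p _; exact: cvg_fst.
  by apply: (@preimage_closed _ _ snd _ _ pL) => p _; exact: cvg_snd.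
have cKL : compact [set: K * L] by rewrite -setXTT; exact: compact_setX.
split.
- exact: collapse_compact.
- by apply: (collapse_compactly_based eA) => //; exact: compactly_based_prod.
- by apply: (collapse_closed_pt eA cA); left.
Qed.

Lemma circle_prod_continuous (X Z : topologicalType) (f : X * circle R -> Z) :
  continuous (fun p : X * unitI R => f (p.1, tbar R p.2)) -> continuous f.
Proof.
apply: (collapse_prod_continuous (@circle_collapse R)).
- by apply: closedU; exact: unitI_closed1.
- exact: unitI_compact.
- exact: unitI_based.
Qed.

Lemma sphere_compact_based_closed (k : nat) :
  [/\ compact [set: sphere R k], compactly_based (sphere R k) &
    closed [set point : sphere R k]].
Proof.
have cS : [/\ compact [set: circle R], compactly_based (circle R) &
    closed [set point : circle R]].
  have cA : closed [set toI R 0; toI R 1].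
    by apply: closedU; exact: unitI_closed1.
  split.
  - by apply: collapse_compact; exact: unitI_compact.
  - apply: (collapse_compactly_based (@circle_collapse R) cA (@unitI_compact R)).
    exact: unitI_based.
  - by apply: (collapse_closed_pt (@circle_collapse R) cA); right.
(* [sphere 1] is [circle] itself and not a smash product with [sphere 0], so it is a second base
   case. *)
elim: k => [|[|k] [cK bK pK]]; last 2 first.
- exact: cS.
- by have [cc bc pc] := cS; exact: smash_based.
split; first exact: bool_compact.
- move=> b U nU; exists [set b]; split; [exact: discrete_set1|exact: compact_set1|].
  by move=> _ ->; exact: nbhs_singleton.
- exact: discrete_closed.
Qed.

Lemma sphere_based (k : nat) : compactly_based (sphere R k).
Proof. by have [] := sphere_compact_based_closed k. Qed.
End Sphere.

(** * Syntax-directed rules for continuity *)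

Section ContinuityRules.
Context {R : realType} {T : topologicalType}.
Implicit Types (X Y Z : topologicalType).

Lemma continuous_cst_fun Z (z : Z) : continuous (fun _ : T => z).
Proof. by move=> x; exact: cvg_cst. Qed.

Lemma continuous_id_fun : continuous (fun x : T => x).
Proof. by move=> x; exact: cvg_id. Qed.

Lemma continuous_comp_fun Y Z (F : Y -> Z) (f : T -> Y) :
  continuous F -> continuous f -> continuous (fun x => F (f x)).
Proof. by move=> cF cf x; apply: continuous_comp; [exact: cf|exact: cF]. Qed.

Lemma continuous_pair Y Z (f : T -> Y) (g : T -> Z) :
  continuous f -> continuous g -> continuous (fun x => (f x, g x)).
Proof. by move=> cf cg x; apply: cvg_pair; [exact: cf|exact: cg]. Qed.

Lemma continuous_fst_fun Y Z (f : T -> Y * Z) :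
  continuous f -> continuous (fun x => (f x).1).
Proof. by apply: continuous_comp_fun => x; exact: cvg_fst. Qed.

Lemma continuous_snd_fun Y Z (f : T -> Y * Z) :
  continuous f -> continuous (fun x => (f x).2).
Proof. by apply: continuous_comp_fun => x; exact: cvg_snd. Qed.

Lemma continuous_ival (f : T -> unitI R) :
  continuous f -> continuous (fun x => ival (f x)).
Proof. by apply: continuous_comp_fun; exact: ival_continuous. Qed.

Lemma continuous_toI (f : T -> R) :
  continuous f -> continuous (fun x => toI R (f x)).
Proof. by apply: continuous_comp_fun; exact: toI_continuous. Qed.

Lemma continuous_tbar (f : T -> unitI R) :
  continuous f -> continuous (fun x => tbar R (f x)).
Proof. by apply: continuous_comp_fun; exact: gclass_continuous. Qed.

Lemma continuous_smash_pair (X Y : ptopologicalType) (f : T -> X) (g : T -> Y) :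
  continuous f -> continuous g -> continuous (fun x => smash_pair (f x) (g x)).
Proof.
move=> cf cg; apply: (continuous_comp_fun (@gclass_continuous _ _)).
exact: continuous_pair.
Qed.

Lemma continuous_inl_fun (X Y : topologicalType) (f : T -> X) :
  continuous f -> continuous (fun x => inl (f x) : X + Y).
Proof.
by apply: continuous_comp_fun; apply/continuousP => U [].
Qed.

Lemma continuous_inr_fun (X Y : topologicalType) (f : T -> Y) :
  continuous f -> continuous (fun x => inr (f x) : X + Y).
Proof.
by apply: continuous_comp_fun; apply/continuousP => U [].
Qed.

Lemma continuous_cone_base (X Y : ptopologicalType) (h : X -> Y) (f : T -> Y) :
  continuous f -> continuous (fun x => cone_base R h (f x)).
Proof.
move=> cf; apply: (continuous_comp_fun (@gclass_continuous _ _)).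
exact: continuous_inl_fun.
Qed.

Lemma continuous_cone_pt (X Y : ptopologicalType) (h : X -> Y)
    (f : T -> X) (g : T -> unitI R) :
  continuous f -> continuous g -> continuous (fun x => cone_pt R h (f x) (g x)).
Proof.
move=> cf cg; apply: (continuous_comp_fun (@gclass_continuous _ _)).
by apply: continuous_inr_fun; exact: continuous_smash_pair.
Qed.

Lemma continuous_add (f g : T -> R) :
  continuous f -> continuous g -> continuous (fun x => f x + g x).
Proof. by move=> cf cg x; apply: cvgD; [exact: cf|exact: cg]. Qed.

Lemma continuous_opp (f : T -> R) : continuous f -> continuous (fun x => - f x).
Proof. by move=> cf x; apply: cvgN; exact: cf. Qed.

Lemma continuous_mul (f g : T -> R) :
  continuous f -> continuous g -> continuous (fun x => f x * g x).
Proof. by move=> cf cg x; apply: cvgM; [exact: cf|exact: cg]. Qed.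

Lemma continuous_maxr (f g : T -> R) :
  continuous f -> continuous g -> continuous (fun x => Num.max (f x) (g x)).
Proof. by move=> cf cg x; apply: continuous_max; [exact: cf|exact: cg]. Qed.

Lemma continuous_minr (f g : T -> R) :
  continuous f -> continuous g -> continuous (fun x => Num.min (f x) (g x)).
Proof. by move=> cf cg x; apply: continuous_min; [exact: cf|exact: cg]. Qed.

(** The preimage of a closed set splits over the closed sets [r <= c] and [c <= r], whose overlap is
    where the two branches agree. *)
Lemma continuous_paste Z (r c : T -> R) (f g : T -> Z) :
  continuous r -> continuous c -> continuous f -> continuous g ->
  (forall x, r x = c x -> f x = g x) ->
  continuous (fun x => if r x <= c x then f x else g x).
Proof.
move=> cr cc cf cg fg; apply/continuous_closedP => A cA.
have cle (a b : T -> R) : continuous a -> continuous b ->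
    closed [set x | a x <= b x].
  move=> ca cb; have -> : [set x | a x <= b x] =
      (fun x => b x - a x) @^-1` [set y | 0 <= y].
    by apply/seteqP; split => x /=; rewrite subr_ge0.
  move/continuous_closedP: (continuous_add cb (continuous_opp ca)); apply.
  exact: closed_ge.
have -> : (fun x => if r x <= c x then f x else g x) @^-1` A =
    ([set x | r x <= c x] `&` f @^-1` A) `|` ([set x | c x <= r x] `&` g @^-1` A).
  apply/seteqP; split => x /=.
    by case: ifPn => [rc Afx|]; [left|rewrite -ltNge => /ltW cr' Agx; right].
  case=> -[le Ax]; first by rewrite le.
  case: ifP => // ge; rewrite fg //; by apply/eqP; rewrite eq_le le ge.
by apply: closedU; apply: closedI; do ?[exact: cle];
  [move/continuous_closedP: cf|move/continuous_closedP: cg]; exact.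
Qed.
End ContinuityRules.

(** The goals that survive [cts] are those with content: continuity of a composite with a map from
    the context, and agreement of the two branches of a conditional where they meet. *)
Ltac cts1 :=
  lazymatch goal with
  | |- continuous (fun x => x) => exact: continuous_id_fun
  | |- continuous fst => move=> ?; exact: cvg_fst
  | |- continuous snd => move=> ?; exact: cvg_snd
  | |- continuous (toI _) => exact: toI_continuous
  | |- continuous (@ival _) => exact: ival_continuous
  | |- continuous (tbar _) => exact: gclass_continuous
  | |- continuous (cone_base _ _) =>
      exact: (continuous_cone_base (f := fun y => y) (@continuous_id_fun _))
  | |- continuous (fun x => if _ then _ else _) => apply: continuous_paste
  | |- continuous (fun x => cone_base _ _ _) => apply: continuous_cone_base
  | |- continuous (fun x => cone_pt _ _ _ _) => apply: continuous_cone_pt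
  | |- continuous (fun x => smash_pair _ _) => apply: continuous_smash_pair
  | |- continuous (fun x => tbar _ _) => apply: continuous_tbar
  | |- continuous (fun x => toI _ _) => apply: continuous_toI
  | |- continuous (fun x => ival _) => apply: continuous_ival
  | |- continuous (fun x => _ + _) => apply: continuous_add
  | |- continuous (fun x => - _) => apply: continuous_opp
  | |- continuous (fun x => _ * _) => apply: continuous_mul
  | |- continuous (fun x => Num.max _ _) => apply: continuous_maxr
  | |- continuous (fun x => Num.min _ _) => apply: continuous_minr
  | |- continuous (fun x => (_, _)) => apply: continuous_pair
  | |- continuous (fun x => fst _) => apply: continuous_fst_fun
  | |- continuous (fun x => snd _) => apply: continuous_snd_fun
  | |- continuous _ => first [assumption | exact: continuous_cst_fun]
  end.
Ltac cts := repeat cts1.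

Lemma sum_prod_continuous (X Y K Z : topologicalType) (F : (X + Y) * K -> Z) :
  continuous (fun p : X * K => F (inl p.1, p.2)) ->
  continuous (fun p : Y * K => F (inr p.1, p.2)) -> continuous F.
Proof.
move=> cl cr [[x|y] k] W nW.
  have [[A B] [nA nB] AB] := cl (x, k) W nW.
  exists (inl @` A, B).
    split=> //; move: nA; rewrite /= !nbhsE => -[A' [oA' A'x] A'A].
    exists (inl @` A'); last by move=> _ [a A'a <-]; exists a => //; exact: A'A.
    split; last by exists x.
    split.
      suff -> : inl @^-1` ([set inl a | a in A'] : set (X + Y)) = A' by [].
      by apply/seteqP; split => a /=; [move=> [b ? [<-]]|move=> ?; exists a].
    suff -> : inr @^-1` ([set inl a | a in A'] : set (X + Y)) = set0.
      exact: open0.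
    by apply/seteqP; split => a //= -[b].
  by move=> [z l] /= [[a Aa <-] Bl]; apply: (AB (a, l)).
have [[A B] [nA nB] AB] := cr (y, k) W nW.
exists (inr @` A, B).
  split=> //; move: nA; rewrite /= !nbhsE => -[A' [oA' A'x] A'A].
  exists (inr @` A'); last by move=> _ [a A'a <-]; exists a => //; exact: A'A.
  split; last by exists y.
  split.
    suff -> : inl @^-1` ([set inr a | a in A'] : set (X + Y)) = set0.
      exact: open0.
    by apply/seteqP; split => a //= -[b].
  suff -> : inr @^-1` ([set inr a | a in A'] : set (X + Y)) = A' by [].
  by apply/seteqP; split => a /=; [move=> [b ? [<-]]|move=> ?; exists a].
by move=> [z l] /= [[a Aa <-] Bl]; apply: (AB (a, l)).
Qed.

(** The coordinates accumulate on the right, so that for an iterated construction the rule can be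
    used again with [Y * K] as parameter space. *)
Lemma smash_prod_continuous (X Y : ptopologicalType) (K Z : topologicalType)
    (F : smash X Y * K -> Z) :
  compactly_based K ->
  continuous (fun p : X * (Y * K) => F (smash_pair p.1 p.2.1, p.2.2)) ->
  continuous F.
Proof.
move=> bK cF; apply: gquot_prod_continuous => //.
have -> : (fun p : X * Y * K => F (gclass _ p.1, p.2)) =
    (fun p => F (smash_pair p.1.1 p.1.2, p.2)).
  by apply/funext => -[[x y] k].
apply: (continuous_comp_fun cF (f := fun p : X * Y * K => (p.1.1, (p.1.2, p.2)))).
by cts.
Qed.

Lemma smash_continuous (X Y : ptopologicalType) (Z : topologicalType)
    (F : smash X Y -> Z) :
  continuous (fun p : X * Y => F (smash_pair p.1 p.2)) -> continuous F.
Proof.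
move=> cF; apply: gquot_continuous.
have -> // : (fun p : X * Y => F (gclass _ p)) =
    (fun p => F (smash_pair p.1 p.2)).
by apply/funext => -[x y].
Qed.

(** * Maps out of suspensions and mapping cones *)

Section Mapcone.
Context {R : realType}.
Local Notation I := (unitI R).

Lemma susp1_prod_continuous (X : ptopologicalType) (K Z : topologicalType)
    (F : susp R 1 X * K -> Z) :
  compactly_based K ->
  continuous (fun p : X * (I * K) => F (smash_pair p.1 (tbar R p.2.1), p.2.2)) ->
  continuous F.
Proof.
move=> bK cF; apply: smash_prod_continuous => //.
(* The circle is moved to the last place, where its quotient map may be multiplied by the arbitrary
   space [X * K]. *)
have cG : continuous (fun p : X * K * circle R => F (smash_pair p.1.1 p.2, p.1.2)).
  apply: circle_prod_continuous.
  apply: (continuous_comp_fun cF (f := fun p : X * K * I => (p.1.1, (p.2, p.1.2)))).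
  by cts.
apply: (continuous_comp_fun cG
  (f := fun p : X * (circle R * K) => ((p.1, p.2.2), p.2.1))).
by cts.
Qed.

Lemma susp1_ind (X : ptopologicalType) (P : susp R 1 X -> Prop) :
  (forall x t, P (smash_pair x (tbar R t))) -> forall c, P c.
Proof.
move=> Pp c; have [[x s] ->] := gclass_surj c.
by have [t ->] := gclass_surj s; exact: Pp.
Qed.

Section OneMap.
Context {X Y : ptopologicalType} {f : X -> Y}.

Lemma mapcone_prod_continuous (K Z : topologicalType) (F : mapcone R f * K -> Z) :
  compactly_based K ->
  continuous (fun p : Y * K => F (cone_base R f p.1, p.2)) ->
  continuous (fun p : X * (I * K) => F (cone_pt R f p.1 p.2.1, p.2.2)) ->
  continuous F.
Proof.
move=> bK cb cc; apply: gquot_prod_continuous => //.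
by apply: sum_prod_continuous => //; apply: smash_prod_continuous.
Qed.

Lemma mapcone_continuous (Z : topologicalType) (F : mapcone R f -> Z) :
  continuous (fun y => F (cone_base R f y)) ->
  continuous (fun p : X * I => F (cone_pt R f p.1 p.2)) -> continuous F.
Proof.
move=> cb cc.
have b1 : compactly_based (bool : topologicalType).
  exact: (@sphere_based R 0).
(* A dummy parameter in [bool], the zero sphere, reduces the claim to the version with parameters;
   it is then frozen at [true]. *)
have : continuous (fun p : mapcone R f * bool => F p.1).
  apply: mapcone_prod_continuous => //.
    by apply: (continuous_comp_fun cb (f := fun p : Y * bool => p.1)); cts.
  by apply: (continuous_comp_fun cc (f := fun p : X * (I * bool) => (p.1, p.2.1))); cts.
move=> cF; apply: (continuous_comp_fun cF (f := fun c => (c, true))); cts.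
Qed.

Lemma mapcone_ind (P : mapcone R f -> Prop) :
  (forall y, P (cone_base R f y)) -> (forall x t, P (cone_pt R f x t)) ->
  forall c, P c.
Proof.
move=> Pb Pc c; have [[y|z] ->] := gclass_surj c; first exact: Pb.
by have [[x t] ->] := gclass_surj z; exact: Pc.
Qed.

Lemma cone_pt0 x : cone_pt R f x (toI R 0) = cone_base R f (f x).
Proof. by apply: gclass_eq; exists x. Qed.

End OneMap.

Lemma smash_ind (X Y : ptopologicalType) (P : smash X Y -> Prop) :
  (forall x y, P (smash_pair x y)) -> forall c, P c.
Proof. by move=> Pp c; have [[x y] ->] := gclass_surj c; exact: Pp. Qed.

Lemma smash_pointl (X Y : ptopologicalType) (y : Y) :
  smash_pair (point : X) y = point.
Proof. by apply: gclass_eq; split=> //; left. Qed.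

Lemma smash_pointr (X Y : ptopologicalType) (x : X) :
  smash_pair x (point : Y) = point.
Proof. by apply: gclass_eq; split=> //; right. Qed.

Lemma tbar_0 : tbar R (toI R 0) = point.
Proof. exact: gclass_eq. Qed.

Lemma tbar_1 : tbar R (toI R 1) = point.
Proof. by []. Qed.

Lemma cone_base_point (X Y : ptopologicalType) (f : X -> Y) :
  cone_base R f point = point.
Proof. by []. Qed.

(** The base point of the mapping cone comes from [Y]. That of the cone on [X] is identified with it
    only through the gluing at parameter 0, which is where [f point = point] enters. *)
Lemma cone_pt_pointl (X Y : ptopologicalType) (f : X -> Y) t :
  f point = point -> cone_pt R f point t = point.
Proof.
move=> fp; rewrite -(cone_base_point f) -[X in _ = cone_base _ _ X]fp -cone_pt0.
by rewrite /cone_pt !smash_pointl.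
Qed.

Lemma cone_pt1 (X Y : ptopologicalType) (f : X -> Y) x :
  f point = point -> cone_pt R f x (toI R 1) = point.
Proof.
move=> fp; rewrite -(@cone_pt_pointl _ _ f (toI R 1)) //.
by rewrite /cone_pt !smash_pointr.
Qed.
End Mapcone.

(* Without this, failed unifications unfold the nested quotients and diverge. *)
Local Opaque gquot smash mapcone gclass gquot_rec smash_rec mapcone_rec.
Local Opaque smash_pair cone_base cone_pt tbar.

(** * Pointed homotopies *)

Section Homotopy.
Context {R : realType}.
Local Notation I := (unitI R).
Local Notation "f ~ g" := (homotopic R f g) (at level 70).
Local Notation "x ∧ y" := (smash_pair x y) (at level 40, left associativity).

Section Relation.
Context {X Y : ptopologicalType}.
Implicit Types f g h : X -> Y.

Lemma homotopic_refl f : pointed_map f -> f ~ f.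
Proof.
move=> [cf fp]; exists (fun p => f p.1); split=> //.
by apply: (continuous_comp_fun cf); cts.
Qed.

Lemma homotopic_sym f g : f ~ g -> g ~ f.
Proof.
move=> [H [cH H0 H1 Hp]]; exists (fun p => H (p.1, toI R (1 - ival p.2))).
split=> [|x|x|t]; rewrite ?ival0 ?ival1 ?subr0 ?subrr //.
by apply: (continuous_comp_fun cH); cts.
Qed.

Lemma homotopic_trans f g h : f ~ g -> g ~ h -> f ~ h.
Proof.
move=> [H [cH H0 H1 Hp]] [K [cK K0 K1 Kp]].
exists (fun p => if ival p.2 <= 2^-1 then H (p.1, toI R (2 * ival p.2))
                 else K (p.1, toI R (2 * ival p.2 - 1))).
split=> [|x|x|t].
- cts; [apply: (continuous_comp_fun cH); cts|apply: (continuous_comp_fun cK); cts|].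
  by move=> x ->; rewrite mulfV ?pnatr_eq0 // subrr H1 K0.
- by rewrite /= ival0 invr_ge0 ler0n mulr0 H0.
- rewrite /= ival1 ifF; last by apply/negbTE; rewrite -ltNge; lra.
  by rewrite (_ : 2 * 1 - 1 = 1) ?K1 //; lra.
- by rewrite /=; case: ifP.
Qed.

Lemma homotopic_mapl f g : f ~ g -> pointed_map f.
Proof.
move=> [H [cH H0 H1 Hp]]; split; last by rewrite -H0.
have -> : f = (fun x => H (x, toI R 0)) by apply/funext => x; rewrite H0.
by apply: (continuous_comp_fun cH); cts.
Qed.

Lemma hclass_eq f g : f ~ g -> hclass R f = hclass R g.
Proof.
move=> fg; apply/seteqP; split => h /=; last exact: homotopic_trans.
by apply: homotopic_trans; exact: homotopic_sym.
Qed.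
End Relation.

Lemma pointed_comp (X Y Z : ptopologicalType) (g : Y -> Z) (f : X -> Y) :
  pointed_map g -> pointed_map f -> pointed_map (g \o f).
Proof.
by move=> [cg gp] [cf fp]; split; [exact: continuous_comp_fun|rewrite /= fp].
Qed.

Lemma pointed_id (X : ptopologicalType) : pointed_map (@idfun X).
Proof. by split=> //; exact: continuous_id_fun. Qed.

Lemma homotopic_compl (X Y Z : ptopologicalType) (k : Y -> Z) (f g : X -> Y) :
  pointed_map k -> f ~ g -> k \o f ~ k \o g.
Proof.
move=> [ck kp] [H [cH H0 H1 Hp]]; exists (k \o H).
split=> [|x|x|t]; rewrite /= ?H0 ?H1 ?Hp //.
exact: continuous_comp_fun.
Qed.

Lemma homotopic_compr (X Y Z : ptopologicalType) (k : X -> Y) (f g : Y -> Z) :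
  pointed_map k -> f ~ g -> f \o k ~ g \o k.
Proof.
move=> [ck kp] [H [cH H0 H1 Hp]]; exists (fun p => H (k p.1, p.2)).
split=> [|x|x|t]; rewrite /= ?H0 ?H1 ?kp //.
apply: (continuous_comp_fun cH); cts.
by apply: (continuous_comp_fun ck); cts.
Qed.

Lemma homotopy_inverse_comp (X Y Z : ptopologicalType) (f : X -> Y) (f' : Y -> X)
    (g : Y -> Z) (g' : Z -> Y) : pointed_map f -> pointed_map g ->
  homotopy_inverse R f f' -> homotopy_inverse R g g' ->
  homotopy_inverse R (g \o f) (f' \o g').
Proof.
move=> pf pg [pf' f'f ff'] [pg' g'g gg']; split; first exact: pointed_comp.
  apply: homotopic_trans f'f.
  exact: (homotopic_compl pf' (homotopic_compr pf g'g)).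
apply: homotopic_trans gg'.
exact: (homotopic_compl pg (homotopic_compr pg' ff')).
Qed.

Lemma homeo_homotopy_inverse (X Y : ptopologicalType) (f : X -> Y) (g : Y -> X) :
  pointed_map f -> pointed_map g -> cancel f g -> cancel g f ->
  homotopy_inverse R f g.
Proof.
move=> pf pg fK gK; split=> //.
  have -> : g \o f = idfun by apply/funext => x /=; rewrite fK.
  exact: homotopic_refl (pointed_id _).
have -> : f \o g = idfun by apply/funext => x /=; rewrite gK.
exact: homotopic_refl (pointed_id _).
Qed.

Lemma homotopy_equivalence_comp (X Y Z : ptopologicalType) (f : X -> Y)
    (g : Y -> Z) : homotopy_equivalence R f -> homotopy_equivalence R g ->
  homotopy_equivalence R (g \o f).
Proof.
move=> [pf [f' hf]] [pg [g' hg]]; split; first exact: pointed_comp.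
by exists (f' \o g'); exact: homotopy_inverse_comp.
Qed.

Lemma homotopy_inverse_unique (X Y : ptopologicalType) (f : X -> Y)
    (g g' : Y -> X) : homotopy_inverse R f g -> homotopy_inverse R f g' -> g ~ g'.
Proof.
move=> [pg gf fg] [pg' g'f fg'].
apply: (@homotopic_trans _ _ _ (g' \o f \o g)).
  exact: homotopic_sym (homotopic_compr pg g'f).
exact: (homotopic_compl pg' fg).
Qed.

(** The common source of homotopies ([K] the interval), of homotopies on iterated cones ([K] the
    square) and of [psi_inv] ([K] a sphere). The hypotheses on [b] and [c] are the gluing relations,
    required for each parameter value. *)
Lemma mapcone_rec_param (X Y Z : ptopologicalType) (f : X -> Y)
    (K : topologicalType) (b : Y -> K -> Z) (c : X -> I -> K -> Z) :
  compactly_based K ->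
  continuous (fun p : Y * K => b p.1 p.2) ->
  continuous (fun p : X * (I * K) => c p.1 p.2.1 p.2.2) ->
  (forall k, b point k = point) -> (forall s k, c point s k = point) ->
  (forall x k, c x (toI R 1) k = point) ->
  (forall x k, c x (toI R 0) k = b (f x) k) ->
  [/\ continuous (fun p : mapcone R f * K =>
        mapcone_rec R (b^~ p.2) (fun x s => c x s p.2) p.1),
      (forall y k, mapcone_rec R (b^~ k) (fun x s => c x s k) (cone_base R f y) = b y k) &
      (forall x s k,
        mapcone_rec R (b^~ k) (fun x s => c x s k) (cone_pt R f x s) = c x s k)].
Proof.
move=> bK cb cc bp cp c1 c0.
have E k : (forall y, mapcone_rec R (b^~ k) (fun x s => c x s k) (cone_base R f y) = b y k) /\
    (forall x s, mapcone_rec R (b^~ k) (fun x s => c x s k) (cone_pt R f x s) = c x s k).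
  by apply: mapcone_recE => [s|x|x]; rewrite ?cp ?bp ?c1 ?c0.
split=> [|y k|x s k]; rewrite ?(proj1 (E _)) ?(proj2 (E _)) //.
apply: mapcone_prod_continuous => //.
  have -> // : (fun p : Y * K => mapcone_rec R (b^~ p.2) (fun x s => c x s p.2)
    (cone_base R f p.1)) = (fun p => b p.1 p.2).
  by apply/funext => p; rewrite (proj1 (E _)).
have -> // : (fun p : X * (I * K) => mapcone_rec R (b^~ p.2.2)
    (fun x s => c x s p.2.2) (cone_pt R f p.1 p.2.1)) =
    (fun p => c p.1 p.2.1 p.2.2).
by apply/funext => p; rewrite (proj2 (E _)).
Qed.

Section MapconeMaps.
Context {X Y Z : ptopologicalType} {f : X -> Y}.

Lemma mapcone_rec_pointed (b : Y -> Z) (c : X -> I -> Z) :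
  continuous b -> continuous (fun p : X * I => c p.1 p.2) ->
  b point = point -> (forall t, c point t = point) ->
  (forall x, c x (toI R 1) = point) -> (forall x, c x (toI R 0) = b (f x)) ->
  [/\ pointed_map (mapcone_rec R b c : mapcone R f -> Z),
      (forall y, mapcone_rec R b c (cone_base R f y) = b y) &
      (forall x t, mapcone_rec R b c (cone_pt R f x t) = c x t)].
Proof.
move=> cb cc bp cp c1 c0.
have [| | |bE cE] := @mapcone_recE R X Y f Z b c.
- by move=> t; rewrite cp bp.
- by move=> x; rewrite c1 bp.
- exact: c0.
split=> //; split; last by rewrite -cone_base_point bE.
apply: mapcone_continuous.
  by have -> : (fun y => mapcone_rec R b c (cone_base R f y)) = b by apply/funext.
have -> : (fun p : X * I => mapcone_rec R b c (cone_pt R f p.1 p.2)) =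
    (fun p => c p.1 p.2) by apply/funext => p; rewrite cE.
by [].
Qed.

Lemma mapcone_homotopic (u v : mapcone R f -> Z) (b : Y -> I -> Z)
    (c : X -> I -> I -> Z) :
  continuous (fun p : Y * I => b p.1 p.2) ->
  continuous (fun p : X * (I * I) => c p.1 p.2.1 p.2.2) ->
  (forall t, b point t = point) -> (forall s t, c point s t = point) ->
  (forall x t, c x (toI R 1) t = point) ->
  (forall x t, c x (toI R 0) t = b (f x) t) ->
  (forall y, b y (toI R 0) = u (cone_base R f y)) ->
  (forall x s, c x s (toI R 0) = u (cone_pt R f x s)) ->
  (forall y, b y (toI R 1) = v (cone_base R f y)) ->
  (forall x s, c x s (toI R 1) = v (cone_pt R f x s)) ->
  u ~ v.
Proof.
move=> cb cc bp cp c1 c0 bu cu bv cv.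
have [cH H1 H2] := mapcone_rec_param (@unitI_based R) cb cc bp cp c1 c0.
exists (fun p => mapcone_rec R (b^~ p.2) (fun x s => c x s p.2) p.1); split.
- exact: cH.
- by apply: mapcone_ind => [y|x s]; rewrite ?H1 ?H2.
- by apply: mapcone_ind => [y|x s]; rewrite ?H1 ?H2.
- by move=> t; rewrite -(cone_base_point f) H1.
Qed.
End MapconeMaps.

Lemma smash_rec_param (X Y Z : ptopologicalType) (K : topologicalType)
    (h : X -> Y -> K -> Z) : compactly_based K ->
  continuous (fun p : X * (Y * K) => h p.1 p.2.1 p.2.2) ->
  (forall y k, h point y k = point) -> (forall x k, h x point k = point) ->
  continuous (fun p : smash X Y * K => smash_rec (fun x y => h x y p.2) p.1) /\
  (forall x y k, smash_rec (fun x y => h x y k) (x ∧ y) = h x y k).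
Proof.
move=> bK ch hl hr.
have E x y k : smash_rec (fun x y => h x y k) (x ∧ y) = h x y k.
  by apply: (smash_recE (fun x y => h x y k) point).
split=> //; apply: smash_prod_continuous => //.
by have -> : (fun p : X * (Y * K) => smash_rec (fun x y => h x y p.2.2)
  (p.1 ∧ p.2.1)) = (fun p => h p.1 p.2.1 p.2.2)
  by apply/funext => p; rewrite E.
Qed.

Lemma smash_rec_pointed (X Y Z : ptopologicalType) (h : X -> Y -> Z) :
  continuous (fun p : X * Y => h p.1 p.2) ->
  (forall y, h point y = point) -> (forall x, h x point = point) ->
  pointed_map (smash_rec h) /\
  (forall x y, smash_rec h (smash_pair x y) = h x y).
Proof.
move=> ch hl hr; have hE := smash_recE h point hl hr.
split=> //; split; last by rewrite -(smash_pointl X (point : Y)) hE.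
apply: smash_continuous.
by have -> : (fun p : X * Y => smash_rec h (smash_pair p.1 p.2)) =
  (fun p => h p.1 p.2) by apply/funext => p; rewrite hE.
Qed.

Lemma smash_homotopic (X Y Z : ptopologicalType) (u v : smash X Y -> Z)
    (h : X -> Y -> I -> Z) :
  continuous (fun p : X * (Y * I) => h p.1 p.2.1 p.2.2) ->
  (forall y t, h point y t = point) -> (forall x t, h x point t = point) ->
  (forall x y, h x y (toI R 0) = u (x ∧ y)) ->
  (forall x y, h x y (toI R 1) = v (x ∧ y)) ->
  u ~ v.
Proof.
move=> ch hl hr hu hv.
have [cH HE] := smash_rec_param (@unitI_based R) ch hl hr.
exists (fun p => smash_rec (fun x y => h x y p.2) p.1); split.
- exact: cH.
- by apply: smash_ind => x y; rewrite HE.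
- by apply: smash_ind => x y; rewrite HE.
- by move=> t; rewrite -(smash_pointl X (point : Y)) HE.
Qed.

(** It has the shape of the body of [coextension], which is thus an instance of it by conversion. *)
Definition susp1_rec {X : ptopologicalType} {Z : Type} (h : X -> I -> Z) :
  susp R 1 X -> Z := smash_rec (fun x => gquot_rec (h x)).

Lemma susp1_rec_param (X Z : ptopologicalType) (K : topologicalType)
    (h : X -> I -> K -> Z) : compactly_based K ->
  continuous (fun p : X * (I * K) => h p.1 p.2.1 p.2.2) ->
  (forall s k, h point s k = point) ->
  (forall x k, h x (toI R 0) k = point) -> (forall x k, h x (toI R 1) k = point) ->
  continuous (fun p : susp R 1 X * K => susp1_rec (fun x s => h x s p.2) p.1) /\
  (forall x s k, susp1_rec (fun x s => h x s k) (x ∧ tbar R s) = h x s k).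
Proof.
move=> bK ch hp h0 h1.
have E x s k : susp1_rec (fun x s => h x s k) (x ∧ tbar R s) = h x s k.
  have gE y t : gquot_rec (fun s => h y s k) (tbar R t) = h y t k.
    by apply: (gquot_recE (f := fun s => h y s k)) => a b [-> ->]; rewrite h0 h1.
  rewrite /susp1_rec (smash_recE (fun x => gquot_rec (fun s => h x s k)) point) //.
    by move=> q; have [t ->] := gclass_surj q; rewrite gE.
  by move=> y; rewrite -(@tbar_1 R) gE.
split=> //; apply: susp1_prod_continuous => //.
by have -> : (fun p : X * (I * K) => susp1_rec (fun x s => h x s p.2.2)
  (p.1 ∧ tbar R p.2.1)) = (fun p => h p.1 p.2.1 p.2.2)
  by apply/funext => p; rewrite E.
Qed.
Lemma susp1_rec_pointed (X Z : ptopologicalType) (h : X -> I -> Z) :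
  continuous (fun p : X * I => h p.1 p.2) -> (forall t, h point t = point) ->
  (forall x, h x (toI R 0) = point) -> (forall x, h x (toI R 1) = point) ->
  pointed_map (susp1_rec h) /\
  (forall x t, susp1_rec h (x ∧ tbar R t) = h x t).
Proof.
move=> ch hp h0 h1.
have [||||cu uE] := @susp1_rec_param X Z I (fun x s _ => h x s) (@unitI_based R).
- apply: (continuous_comp_fun ch (f := fun p : X * (I * I) => (p.1, p.2.1))).
  by cts.
- by move=> s _; exact: hp.
- by move=> x _; exact: h0.
- by move=> x _; exact: h1.
have {}uE x t : susp1_rec h (x ∧ tbar R t) = h x t := uE x t (toI R 0).
split=> //; split; last first.
  by rewrite -(smash_pointl X (tbar R (toI R 0))) uE hp.
by apply: (continuous_comp_fun cu (f := fun q => (q, toI R 0))); cts.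
Qed.

Lemma susp1_homotopic (X Z : ptopologicalType) (u v : susp R 1 X -> Z)
    (h : X -> I -> I -> Z) :
  continuous (fun p : X * (I * I) => h p.1 p.2.1 p.2.2) ->
  (forall s t, h point s t = point) ->
  (forall x t, h x (toI R 0) t = point) -> (forall x t, h x (toI R 1) t = point) ->
  (forall x s, h x s (toI R 0) = u (x ∧ tbar R s)) ->
  (forall x s, h x s (toI R 1) = v (x ∧ tbar R s)) ->
  u ~ v.
Proof.
move=> ch hp h0 h1 hu hv.
have [cH HE] := susp1_rec_param (@unitI_based R) ch hp h0 h1.
exists (fun p => susp1_rec (fun x s => h x s p.2) p.1); split.
- exact: cH.
- by apply: susp1_ind => x s; rewrite HE.
- by apply: susp1_ind => x s; rewrite HE.
- by move=> t; rewrite -(smash_pointl X (tbar R (toI R 0))) HE.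
Qed.
End Homotopy.

(** * The basic maps: suspension, switch, [psi], pinch and coextension *)

Section Maps.
Context {R : realType}.
Local Notation I := (unitI R).
Local Notation "f ~ g" := (homotopic R f g) (at level 70).
Local Notation "x ∧ y" := (smash_pair x y) (at level 40, left associativity).

Section Smap.
Context (k : nat).

Lemma smap_pointed (X Y : ptopologicalType) (f : X -> Y) : pointed_map f ->
  pointed_map (smap R k f) /\ (forall x s, smap R k f (x ∧ s) = f x ∧ s).
Proof.
move=> [cf fp]; apply: smash_rec_pointed => [|y|x].
- by cts; apply: (continuous_comp_fun cf); cts.
- by rewrite fp smash_pointl.
- by rewrite smash_pointr.
Qed.

Lemma smap_comp (X Y Z : ptopologicalType) (f : X -> Y) (g : Y -> Z) :
  pointed_map f -> pointed_map g -> smap R k (g \o f) = smap R k g \o smap R k f.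
Proof.
move=> pf pg; have [_ fE] := smap_pointed pf; have [_ gE] := smap_pointed pg.
have [_ E] := smap_pointed (pointed_comp pg pf).
by apply/funext; apply: smash_ind => x s; rewrite E /= fE gE.
Qed.

Lemma smap_id (X : ptopologicalType) : smap R k (@idfun X) = idfun.
Proof.
have [_ E] := smap_pointed (@pointed_id X).
by apply/funext; apply: smash_ind => x s; rewrite E.
Qed.

Lemma smap_homotopic (X Y : ptopologicalType) (f g : X -> Y) :
  f ~ g -> smap R k f ~ smap R k g.
Proof.
move=> fg; have pf := homotopic_mapl fg; have pg := homotopic_mapl (homotopic_sym fg).
have [_ fE] := smap_pointed pf; have [_ gE] := smap_pointed pg.
move: fg => [H [cH H0 H1 Hp]].
apply: (@smash_homotopic _ _ _ _ _ _ (fun x s t => H (x, t) ∧ s)) => [|s t|x t|x s|x s].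
- by cts; apply: (continuous_comp_fun cH); cts.
- by rewrite Hp smash_pointl.
- by rewrite smash_pointr.
- by rewrite H0 fE.
- by rewrite H1 gE.
Qed.

Lemma smap_equivalence (X Y : ptopologicalType) (f : X -> Y) :
  homotopy_equivalence R f -> homotopy_equivalence R (smap R k f).
Proof.
move=> [pf [g [pg gf fg]]]; split; first by have [] := smap_pointed pf.
exists (smap R k g); split; first by have [] := smap_pointed pg.
  by rewrite -smap_comp // -smap_id; exact: smap_homotopic.
by rewrite -smap_comp // -smap_id; exact: smap_homotopic.
Qed.
End Smap.

(** The inner [smash_rec] has to be continuous jointly in [u] and [b], whence the assumption on
    [B]. *)
Lemma switch_pointed (Z A B : ptopologicalType) : compactly_based B ->
  pointed_map (@switch Z A B) /\
  (forall (z : Z) (a : A) (b : B), switch (z ∧ a ∧ b) = z ∧ b ∧ a).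
Proof.
move=> bB.
have [|||cs sE] := @smash_rec_param Z A (smash (smash Z B) A) B
  (fun z a (b : B) => z ∧ b ∧ a) bB.
- by cts.
- by move=> a b; rewrite !smash_pointl.
- by move=> z b; rewrite smash_pointr.
have [|||ps E] := @smash_rec_pointed (smash Z A) B (smash (smash Z B) A)
  (fun (u : smash Z A) (b : B) => smash_rec (fun (z : Z) (a : A) => z ∧ b ∧ a) u).
- exact: cs.
- by move=> b; rewrite -(smash_pointl Z (point : A)) sE smash_pointr.
- by move=> u; move: u; apply: smash_ind => z a; rewrite sE smash_pointr smash_pointl.
- by split=> // z a b; rewrite /switch E sE.
Qed.

Section Psi.
Context (l : nat) {X Y : ptopologicalType} (f : X -> Y) (pf : pointed_map f).

(** Makes [psi] a homeomorphism. Continuity of [psi] uses the compact neighbourhoods of the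
    interval, continuity of [psi_inv] those of the sphere. *)
Definition psi_inv : susp R l (mapcone R f) -> mapcone R (smap R l f) :=
  smash_rec (fun c s => mapcone_rec R (fun y => cone_base R (smap R l f) (y ∧ s))
    (fun x t => cone_pt R (smap R l f) (x ∧ s) t) c).

Lemma psi_pointed : [/\ pointed_map (psi R l f),
  (forall y s, psi R l f (cone_base R _ (y ∧ s)) = cone_base R f y ∧ s) &
  (forall x s t, psi R l f (cone_pt R _ (x ∧ s) t) = cone_pt R f x t ∧ s)].
Proof.
have [cf fp] := pf; have [[csf sfp] sfE] := smap_pointed l pf.
have [|||[cb pb] bE] := @smash_rec_pointed Y (sphere R l) _
    (fun y s => cone_base R f y ∧ s).
- by cts.
- by move=> s; rewrite cone_base_point smash_pointl.
- by move=> y; rewrite smash_pointr.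
have [|||cc cE] := @smash_rec_param X (sphere R l) _ I
    (fun x s t => cone_pt R f x t ∧ s) (@unitI_based R).
- by cts.
- by move=> s t; rewrite cone_pt_pointl // smash_pointl.
- by move=> x t; rewrite smash_pointr.
have [|||||| p E1 E2] := @mapcone_rec_pointed R _ _ _ (smap R l f)
    (smash_rec (fun y s => cone_base R f y ∧ s))
    (fun u t => smash_rec (fun x s => cone_pt R f x t ∧ s) u).
- exact: cb.
- exact: cc.
- exact: pb.
- by move=> t; rewrite -(smash_pointl X (point : sphere R l)) cE cone_pt_pointl // smash_pointl.
- by apply: smash_ind => x s; rewrite cE cone_pt1 // smash_pointl.
- by apply: smash_ind => x s; rewrite cE cone_pt0 sfE bE.
- by split=> // [y s|x s t]; rewrite /psi ?E1 ?E2 ?bE ?cE.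
Qed.

Lemma psi_inv_pointed : [/\ pointed_map psi_inv,
  (forall y s, psi_inv (cone_base R f y ∧ s) = cone_base R _ (y ∧ s)) &
  (forall x t s, psi_inv (cone_pt R f x t ∧ s) = cone_pt R _ (x ∧ s) t)].
Proof.
have [cf fp] := pf; have [[csf sfp] sfE] := smap_pointed l pf.
have [||||||cc E1 E2] := @mapcone_rec_param R X Y _ f (sphere R l)
    (fun y (s : sphere R l) => cone_base R (smap R l f) (y ∧ s))
    (fun x t (s : sphere R l) => cone_pt R (smap R l f) (x ∧ s) t) (@sphere_based R l).
- by cts.
- by cts.
- by move=> s; rewrite smash_pointl.
- by move=> t s; rewrite smash_pointl cone_pt_pointl.
- by move=> x s; rewrite cone_pt1.
- by move=> x s; rewrite cone_pt0 sfE.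
have [|||p E] := @smash_rec_pointed (mapcone R f) (sphere R l) _
  (fun c s => mapcone_rec R (fun y => cone_base R (smap R l f) (y ∧ s))
    (fun x t => cone_pt R (smap R l f) (x ∧ s) t) c).
- exact: cc.
- by move=> s; rewrite -(cone_base_point f) E1 smash_pointl.
- by apply: mapcone_ind => [y|x t]; rewrite ?E1 ?E2 smash_pointr // cone_pt_pointl.
- by split=> // *; rewrite /psi_inv E ?E1 ?E2.
Qed.

Lemma psiK : cancel (psi R l f) psi_inv.
Proof.
have [_ pE1 pE2] := psi_pointed; have [_ qE1 qE2] := psi_inv_pointed.
apply: mapcone_ind => [|u t]; first by apply: smash_ind => y s; rewrite pE1 qE1.
by move: u; apply: smash_ind => x s; rewrite pE2 qE2.
Qed.

Lemma psi_invK : cancel psi_inv (psi R l f).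
Proof.
have [_ pE1 pE2] := psi_pointed; have [_ qE1 qE2] := psi_inv_pointed.
apply: smash_ind => c s; move: c.
by apply: mapcone_ind => [y|x t]; rewrite ?qE1 ?qE2 ?pE1 ?pE2.
Qed.
End Psi.

Lemma mapcone_map_pointed (X Y X' Y' : ptopologicalType) (f : X -> Y)
    (f' : X' -> Y') (h : Y -> Y') (k : X -> X') :
  pointed_map f' -> pointed_map h -> pointed_map k ->
  (forall x, h (f x) = f' (k x)) ->
  [/\ pointed_map (mapcone_map R h k : mapcone R f -> mapcone R f'),
      (forall y, mapcone_map R h k (cone_base R f y) = cone_base R f' (h y)) &
      (forall x t, mapcone_map R h k (cone_pt R f x t) = cone_pt R f' (k x) t)].
Proof.
move=> [_ fp'] [ch hp] [ck kp] E; apply: mapcone_rec_pointed => [||||x|x].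
- by cts.
- by cts; apply: (continuous_comp_fun ck); cts.
- by rewrite hp.
- by move=> t; rewrite kp cone_pt_pointl.
- by rewrite cone_pt1.
- by rewrite cone_pt0 E.
Qed.

Lemma mapcone_map_cancel (X Y X' Y' : ptopologicalType) (f : X -> Y)
    (f' : X' -> Y') (h : Y -> Y') (k : X -> X') (h' : Y' -> Y) (k' : X' -> X) :
  pointed_map f -> pointed_map f' ->
  pointed_map h -> pointed_map k -> pointed_map h' -> pointed_map k' ->
  (forall x, h (f x) = f' (k x)) -> (forall x, h' (f' x) = f (k' x)) ->
  cancel h h' -> cancel k k' ->
  cancel (mapcone_map R h k : mapcone R f -> mapcone R f')
         (mapcone_map R h' k' : mapcone R f' -> mapcone R f).
Proof.
move=> pf pf' ph pk ph' pk' E E' hK kK.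
have [_ A1 A2] := mapcone_map_pointed pf' ph pk E.
have [_ B1 B2] := mapcone_map_pointed pf ph' pk' E'.
by apply: mapcone_ind => [y|x t]; rewrite ?A1 ?A2 ?B1 ?B2 ?hK ?kK.
Qed.

Lemma pinch_pointed (X Y : ptopologicalType) (f : X -> Y) :
  [/\ pointed_map (pinch R : mapcone R f -> _),
      (forall y, pinch R (cone_base R f y) = point) &
      (forall x t, pinch R (cone_pt R f x t) = x ∧ tbar R t)].
Proof.
apply: mapcone_rec_pointed => [|||t|x|x] //.
- exact: continuous_cst_fun.
- by cts.
- by rewrite smash_pointl.
- by rewrite tbar_1 smash_pointr.
- by rewrite tbar_0 smash_pointr.
Qed.

Lemma qprime_pointed (X Y : ptopologicalType) (f : X -> Y) :
  [/\ pointed_map (qprime R f),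
      (forall c, qprime R f (cone_base R _ c) = pinch R c) &
      (forall y t, qprime R f (cone_pt R _ y t) = point)].
Proof.
have [[cp pp] p1 p2] := pinch_pointed f.
apply: mapcone_rec_pointed => [||| | |y].
- exact: cp.
- exact: continuous_cst_fun.
- exact: pp.
- by [].
- by [].
- by rewrite p1.
Qed.

Lemma coextension_pointed (X Y Z : ptopologicalType) (f : Y -> Z)
    (A : X * I -> Z) (g : X -> Y) :
  pointed_map f -> pointed_map g -> null_homotopy R (f \o g) A ->
  pointed_map (coextension R f A g) /\
  (forall x t, coextension R f A g (x ∧ tbar R t) =
    if ival t <= 2^-1 then cone_pt R f (g x) (toI R (1 - 2 * ival t))
    else cone_base R f (A (x, toI R (2 * ival t - 1)))).
Proof.
move=> [cf fp] [cg gp] [cA A0 A1 Ap].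
apply: (@susp1_rec_pointed R X _ (fun x t => if ival t <= 2^-1
    then cone_pt R f (g x) (toI R (1 - 2 * ival t))
    else cone_base R f (A (x, toI R (2 * ival t - 1))))) => [|t|x|x].
- cts; [apply: (continuous_comp_fun cg); cts|apply: (continuous_comp_fun cA); cts|].
  by move=> p ->; rewrite mulfV ?pnatr_eq0 // subrr A0 cone_pt0.
- by case: ifP => _; rewrite ?gp ?cone_pt_pointl ?Ap.
- by rewrite ival0 invr_ge0 ler0n mulr0 subr0 cone_pt1.
- rewrite ival1 ifF; last by apply/negbTE; rewrite -ltNge; lra.
  by rewrite (_ : 2 * 1 - 1 = 1) ?A1 //; lra.
Qed.
End Maps.

(** * The structure maps are homotopy equivalences *)

Section Equivalences.
Context {R : realType}.
Local Notation I := (unitI R).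
Local Notation "f ~ g" := (homotopic R f g) (at level 70).
Local Notation "x ∧ y" := (smash_pair x y) (at level 40, left associativity).

(** Interpolating linearly gives [u * (1 + t) - t], clamped to the interval, which keeps both ends
    at the base point. Such [v] arise when a coextension is followed by the collapse of its first
    half. *)
Lemma stretch_homotopic (X : ptopologicalType) (v : susp R 1 X -> susp R 1 X) :
  (forall x u, v (x ∧ tbar R u) = x ∧ tbar R (toI R (2 * ival u - 1))) ->
  v ~ idfun.
Proof.
move=> vE; apply: homotopic_sym.
apply: (@susp1_homotopic R _ _ _ _
  (fun x u t => x ∧ tbar R (toI R (ival u * (1 + ival t) - ival t)))) => [|u t|x t|x t|x u|x u].
- by cts.
- by rewrite smash_pointl.
- rewrite ival0 toI_le0 ?tbar_0 ?smash_pointr //.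
  by have := ival_ge0 t; lra.
- by rewrite ival1 toI_ge1 ?tbar_1 ?smash_pointr //; lra.
- by rewrite ival0 addr0 mulr1 subr0 ivalK.
- by rewrite vE ival1; do ?[congr (_ ∧ _); congr (tbar R (toI R _))]; lra.
Qed.

(* [t |-> (s (1 + t) - t)] pushes the cone parameter [s] down by [t]; what falls
   below 0 is absorbed by the contraction of the collapsed part. *)
Section Pinch.
Context {X Y : ptopologicalType} (f : X -> Y) (pf : pointed_map f).
Context (K : Y * I -> Y) (nK : null_homotopy R (@idfun Y) K).

(** A coextension run in the other order: first back along the contraction of [Y], from the base
    point to [f x], then up the cone on [x]. *)
Definition pinch_inv : susp R 1 X -> mapcone R f := susp1_rec (fun x u =>
  if ival u <= 2^-1 then cone_base R f (K (f x, toI R (1 - 2 * ival u)))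
  else cone_pt R f x (toI R (2 * ival u - 1))).

Lemma pinch_equivalence : homotopy_equivalence R (pinch R : mapcone R f -> _).
Proof.
have [cf fp] := pf; have [cK K0 K1 Kp] := nK.
have [pp pb pc] := @pinch_pointed R _ _ f; split=> //.
have [|t|x|x|pr rE] := @susp1_rec_pointed R X _ (fun x (u : I) =>
  if ival u <= 2^-1 then cone_base R f (K (f x, toI R (1 - 2 * ival u)))
  else cone_pt R f x (toI R (2 * ival u - 1))).
- cts; first by apply: (continuous_comp_fun cK); cts; apply: (continuous_comp_fun cf); cts.
  by move=> p ->; rewrite mulfV ?pnatr_eq0 // subrr K0 cone_pt0.
- by case: ifP => _; rewrite ?fp ?Kp ?cone_base_point ?cone_pt_pointl.
- by rewrite ival0 invr_ge0 ler0n mulr0 subr0 K1 cone_base_point.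
- rewrite ival1 ifF; last by apply/negbTE; rewrite -ltNge; lra.
  by rewrite (_ : 2 * 1 - 1 = 1) ?cone_pt1 //; lra.
rewrite -/pinch_inv in pr rE; have [_ rp] := pr.
exists pinch_inv; split=> //.
- apply: homotopic_sym; apply: (@mapcone_homotopic R _ _ _ f _ _
    (fun y t => cone_base R f (K (y, t)))
    (fun x s t => if ival s * (1 + ival t) <= ival t
       then cone_base R f (K (f x, toI R (ival t - ival s * (1 + ival t))))
       else cone_pt R f x (toI R (ival s * (1 + ival t) - ival t)))).
  + by cts; apply: (continuous_comp_fun cK); cts.
  + cts; first by apply: (continuous_comp_fun cK); cts; apply: (continuous_comp_fun cf); cts.
    by move=> p ->; rewrite subrr K0 cone_pt0.
  + by move=> t; rewrite Kp cone_base_point.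
  + by move=> s t; case: ifP => _; rewrite ?fp ?Kp ?cone_base_point ?cone_pt_pointl.
  + move=> x t; rewrite ival1 ifF; last by apply/negbTE; rewrite -ltNge; lra.
    by rewrite toI_ge1 ?cone_pt1 //; lra.
  + by move=> x t; rewrite ival0 mul0r ival_ge0 subr0 ivalK.
  + by move=> y; rewrite K0.
  + move=> x s; rewrite ival0 addr0 mulr1 subr0 sub0r ivalK.
    (* At time 0 the first branch is taken only for [s = 0], where both branches give [f x]. *)
    case: ifP => // s0; have s00 : ival s = 0 by have := ival_ge0 s; lra.
    by rewrite s00 oppr0 K0 -(ivalK s) s00 /= cone_pt0.
  + by move=> y /=; rewrite K1 pb cone_base_point rp.
  + move=> x s /=; rewrite pc rE ival1.
    have [h|h] := lerP (ival s) 2^-1.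
      by rewrite ifT; [congr (cone_base R f (K (_, toI R _)))|]; lra.
    by rewrite ifF; [congr (cone_pt R f _ (toI R _))|apply/negbTE; rewrite -ltNge]; lra.
- apply: stretch_homotopic => x u /=; rewrite rE.
  have [h|h] := lerP (ival u) 2^-1; last by rewrite pc.
  by rewrite pb toI_le0 ?tbar_0 ?smash_pointr //; lra.
Qed.
End Pinch.

Lemma cone_contraction (Y : ptopologicalType) :
  exists K, null_homotopy R (@idfun (mapcone R (@idfun Y))) K.
Proof.
have [H [cH H0 H1 Hp]] : @idfun (mapcone R (@idfun Y)) ~ (fun _ => point).
  apply: (@mapcone_homotopic R _ _ _ _ _ _
    (fun y t => cone_pt R (@idfun Y) y t)
    (* [s + t - s * t] is [1 - (1 - s) * (1 - t)]: it stays in the interval, moves [s] to 1, and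
       equals [t] on the base [s = 0], as the gluing demands. *)
    (fun y s t => cone_pt R (@idfun Y) y
       (toI R (ival s + ival t - ival s * ival t)))) => //.
  - by cts.
  - by cts.
  - by move=> t; rewrite cone_pt_pointl.
  - by move=> s t; rewrite cone_pt_pointl.
  - by move=> y t; rewrite ival1 mul1r addrK cone_pt1.
  - by move=> y t; rewrite ival0 mul0r subr0 add0r ivalK.
  - by move=> y; rewrite cone_pt0.
  - by move=> y s; rewrite ival0 mulr0 subr0 addr0 ivalK.
  - by move=> y; rewrite cone_pt1.
  - by move=> y s; rewrite ival1 mulr1 addrAC subrr add0r cone_pt1.
by exists H.
Qed.

Section Qprime.
Context {X Y : ptopologicalType} (f : X -> Y) (pf : pointed_map f).

Definition cone_null_homotopy (p : X * I) : mapcone R f := cone_pt R f p.1 p.2.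

Lemma cone_null_homotopyP :
  null_homotopy R (cone_base R f \o f) cone_null_homotopy.
Proof.
have [_ fp] := pf; split=> [|x|x|t]; rewrite /cone_null_homotopy /=.
- by cts.
- by rewrite cone_pt0.
- by rewrite cone_pt1.
- by rewrite cone_pt_pointl.
Qed.

Lemma cone_base_pointed : pointed_map (cone_base R f).
Proof.
split; last exact: cone_base_point.
by cts.
Qed.

(** The inverse is kept explicit because the canonical [g32] is computed from it. *)
Definition qprime_inv : susp R 1 X -> mapcone R (cone_base R f) :=
  coextension R (cone_base R f) cone_null_homotopy f.

(** The homotopy follows the pattern of the pinch map, with the attached cone on [Y] in the role of
    a contraction: a point of the cone on [X] is pushed down, and once it passes the base it climbs
    the cone line over [f x], while [Y] itself rises to the vertex. *)
Lemma qprime_inverse : homotopy_inverse R (qprime R f) qprime_inv.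
Proof.
have [cf fp] := pf; have pb := cone_base_pointed.
have [pr rE] := coextension_pointed pb pf cone_null_homotopyP.
have [pq qb qc] := @qprime_pointed R _ _ f.
have [pp ppb ppc] := @pinch_pointed R _ _ f.
have [||||||cb bE1 bE2] := @mapcone_rec_param R X Y (mapcone R (cone_base R f)) f I
  (fun y t => cone_pt R (cone_base R f) y t)
  (fun x s t => if ival s * (1 + ival t) <= ival t
       then cone_pt R (cone_base R f) (f x) (toI R (ival t - ival s * (1 + ival t)))
       else cone_base R (cone_base R f)
         (cone_pt R f x (toI R (ival s * (1 + ival t) - ival t)))) (@unitI_based R).
- by cts.
- cts; first by apply: (continuous_comp_fun cf); cts.
  by move=> p ->; rewrite subrr !cone_pt0.
- by move=> t; rewrite cone_pt_pointl.
- by move=> s t; case: ifP => _; rewrite ?fp ?cone_pt_pointl.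
- move=> x t; rewrite ival1 ifF; last by apply/negbTE; rewrite -ltNge; lra.
  by rewrite toI_ge1 ?cone_pt1 //; lra.
- by move=> x t; rewrite ival0 mul0r ival_ge0 subr0 ivalK.
pose b (c : mapcone R f) (t : I) := mapcone_rec R
  (fun y => cone_pt R (cone_base R f) y t)
  (fun x s => if ival s * (1 + ival t) <= ival t
     then cone_pt R (cone_base R f) (f x) (toI R (ival t - ival s * (1 + ival t)))
     else cone_base R (cone_base R f)
       (cone_pt R f x (toI R (ival s * (1 + ival t) - ival t)))) c.
have rp : qprime_inv point = point by have [] := pr.
have {}bE1 y t : b (cone_base R f y) t = _ := bE1 y t.
have {}bE2 x s t : b (cone_pt R f x s) t = _ := bE2 x s t.
split=> //.
- apply: homotopic_sym; apply: (@mapcone_homotopic R _ _ _ _ _ _ b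
    (fun y s t => cone_pt R (cone_base R f) y
       (toI R (ival s + ival t - ival s * ival t))) cb).
  + by cts.
  + by move=> t; rewrite -(cone_base_point f) bE1 cone_pt_pointl.
  + by move=> s t; rewrite cone_pt_pointl.
  + by move=> y t; rewrite ival1 mul1r addrK cone_pt1.
  + by move=> y t; rewrite ival0 mul0r subr0 add0r ivalK bE1.
  + apply: mapcone_ind => [y|x s]; rewrite ?bE1 ?cone_pt0 //.
    rewrite bE2 ival0 addr0 mulr1 subr0 sub0r ivalK.
    case: ifP => // s0; have s00 : ival s = 0 by have := ival_ge0 s; lra.
    by rewrite s00 oppr0 -(ivalK s) s00 !cone_pt0.
  + by move=> y s; rewrite ival0 mulr0 subr0 addr0 ivalK.
  + apply: mapcone_ind => [y|x s] /=; rewrite qb.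
      by rewrite bE1 ppb cone_pt1 // rp.
    rewrite bE2 ppc /qprime_inv rE ival1.
    have [h|h] := lerP (ival s) 2^-1.
      by rewrite ifT; [congr (cone_pt R _ _ (toI R _))|]; lra.
    rewrite ifF; last by apply/negbTE; rewrite -ltNge; lra.
    by congr (cone_base R _ (cone_pt R _ _ (toI R _))); lra.
  + by move=> y s /=; rewrite ival1 mulr1 addrAC subrr add0r cone_pt1 // qc rp.
- apply: stretch_homotopic => x u /=; rewrite /qprime_inv rE.
  have [h|h] := lerP (ival u) 2^-1; rewrite ?qb ?qc ?ppc //.
  by rewrite toI_le0 ?tbar_0 ?smash_pointr //; lra.
Qed.

Lemma qprime_equivalence : homotopy_equivalence R (qprime R f).
Proof.
split; first by have [] := @qprime_pointed R _ _ f.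
by exists qprime_inv; exact: qprime_inverse.
Qed.
End Qprime.

(* The iterated mapping cones of the rows and of the columns of a commutative
   square [h \o j = k \o f] agree; [cone_exchange] is the case [k = idfun]. *)
Definition square_exchange (A B Y Z : ptopologicalType) (j : A -> B)
    (f : A -> Y) (h : B -> Z) (k : Y -> Z)
    (G : mapcone R f -> mapcone R h) (F : mapcone R j -> mapcone R k) :
    mapcone R G -> mapcone R F :=
  mapcone_rec R
    (mapcone_rec R (fun z => cone_base R F (cone_base R k z))
                   (fun b t => cone_pt R F (cone_base R j b) t))
    (fun c t => mapcone_rec R
                 (fun y => cone_base R F (cone_pt R k y t))
                 (fun a s => cone_pt R F (cone_pt R j a t) s) c).

Arguments square_exchange {A B Y Z j f h k} G F _.

Lemma square_exchange_pointed (A B Y Z : ptopologicalType) (j : A -> B)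
    (f : A -> Y) (h : B -> Z) (k : Y -> Z)
    (G : mapcone R f -> mapcone R h) (F : mapcone R j -> mapcone R k) :
  pointed_map j -> pointed_map f -> pointed_map h -> pointed_map k ->
  pointed_map F ->
  (forall y, G (cone_base R f y) = cone_base R h (k y)) ->
  (forall a t, G (cone_pt R f a t) = cone_pt R h (j a) t) ->
  (forall b, F (cone_base R j b) = cone_base R k (h b)) ->
  (forall a t, F (cone_pt R j a t) = cone_pt R k (f a) t) ->
  [/\ pointed_map (square_exchange G F),
      (forall z, square_exchange G F (cone_base R G (cone_base R h z)) =
                 cone_base R F (cone_base R k z)),
      (forall b t, square_exchange G F (cone_base R G (cone_pt R h b t)) =
                   cone_pt R F (cone_base R j b) t),
      (forall y t, square_exchange G F (cone_pt R G (cone_base R f y) t) =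
                   cone_base R F (cone_pt R k y t)) &
      (forall a s t, square_exchange G F (cone_pt R G (cone_pt R f a s) t) =
                     cone_pt R F (cone_pt R j a t) s)].
Proof.
move=> [_ jp] [_ fp] [_ hp] [_ kp] [_ Fp] Gb Gc Fb Fc.
have Fpt : cone_base R F point = point by exact: cone_base_point.
have [||||||[cu up] uE1 uE2] := @mapcone_rec_pointed R _ _ _ h
  (fun z => cone_base R F (cone_base R k z))
  (fun b t => cone_pt R F (cone_base R j b) t).
- by cts.
- by cts.
- by rewrite (@cone_base_point R _ _ k) Fpt.
- by move=> t; rewrite (@cone_base_point R _ _ j) cone_pt_pointl.
- by move=> b; rewrite cone_pt1.
- by move=> b; rewrite cone_pt0 Fb.
have [||||||cv vE1 vE2] := @mapcone_rec_param R _ _ _ f I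
  (fun y t => cone_base R F (cone_pt R k y t))
  (fun a s t => cone_pt R F (cone_pt R j a t) s) (@unitI_based R).
- by cts.
- by cts.
- by move=> t; rewrite (@cone_pt_pointl R _ _ k).
- by move=> s t; rewrite (@cone_pt_pointl R _ _ j) ?cone_pt_pointl.
- by move=> a t; rewrite cone_pt1.
- by move=> a t; rewrite cone_pt0 Fc.
have [|||t|c|c|px xE1 xE2] := @mapcone_rec_pointed R _ _ _ G
  (mapcone_rec R (fun z => cone_base R F (cone_base R k z))
     (fun b t => cone_pt R F (cone_base R j b) t))
  (fun c t => mapcone_rec R
     (fun y => cone_base R F (cone_pt R k y t))
     (fun a s => cone_pt R F (cone_pt R j a t) s) c).
- exact: cu.
- exact: cv.
- exact: up.
- by rewrite -(cone_base_point f) vE1 (@cone_pt_pointl R _ _ k).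
- move: c; apply: mapcone_ind => [y|a s]; first by rewrite vE1 cone_pt1.
  by rewrite vE2 (@cone_pt1 R _ _ j) ?cone_pt_pointl.
- move: c; apply: mapcone_ind => [y|a s].
    by rewrite vE1 Gb uE1 cone_pt0.
  by rewrite vE2 Gc uE2 cone_pt0.
rewrite /square_exchange; split; first exact: px.
- by move=> z; rewrite xE1 uE1.
- by move=> b t; rewrite xE1 uE2.
- by move=> y t; rewrite xE2 vE1.
- by move=> a s t; rewrite xE2 vE2.
Qed.

(** Exchanging the parameters twice is the identity, so the inverse is the exchange of the
    transposed square. Transposition swaps [h] and [k], which is why [k] is kept general. *)
Lemma square_exchange_equivalence (A B Y Z : ptopologicalType) (j : A -> B)
    (f : A -> Y) (h : B -> Z) (k : Y -> Z)
    (G : mapcone R f -> mapcone R h) (F : mapcone R j -> mapcone R k) :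
  pointed_map j -> pointed_map f -> pointed_map h -> pointed_map k ->
  pointed_map G -> pointed_map F ->
  (forall y, G (cone_base R f y) = cone_base R h (k y)) ->
  (forall a t, G (cone_pt R f a t) = cone_pt R h (j a) t) ->
  (forall b, F (cone_base R j b) = cone_base R k (h b)) ->
  (forall a t, F (cone_pt R j a t) = cone_pt R k (f a) t) ->
  homotopy_equivalence R (square_exchange G F).
Proof.
move=> pj pf ph pk pG pF Gb Gc Fb Fc.
have [px x1 x2 x3 x4] := square_exchange_pointed pj pf ph pk pF Gb Gc Fb Fc.
have [py y1 y2 y3 y4] := square_exchange_pointed pf pj pk ph pG Fb Fc Gb Gc.
split; first exact: px.
exists (square_exchange F G).
apply: homeo_homotopy_inverse; [exact: px|exact: py| |].
- apply: mapcone_ind => [|c t].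
    apply: mapcone_ind => [z|b t].
      exact: etrans (congr1 (square_exchange F G) (x1 z)) (y1 z).
    exact: etrans (congr1 (square_exchange F G) (x2 b t)) (y3 b t).
  move: c; apply: mapcone_ind => [y|a s].
    exact: etrans (congr1 (square_exchange F G) (x3 y t)) (y2 y t).
  exact: etrans (congr1 (square_exchange F G) (x4 a s t)) (y4 a t s).
- apply: mapcone_ind => [|c t].
    apply: mapcone_ind => [z|y t].
      exact: etrans (congr1 (square_exchange G F) (y1 z)) (x1 z).
    exact: etrans (congr1 (square_exchange G F) (y2 y t)) (x3 y t).
  move: c; apply: mapcone_ind => [b|a s].
    exact: etrans (congr1 (square_exchange G F) (y3 b t)) (x2 b t).
  exact: etrans (congr1 (square_exchange G F) (y4 a s t)) (x4 a t s).
Qed.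

Lemma cone_exchange_equivalence (A B Y : ptopologicalType) (j : A -> B)
    (h : B -> Y) (f : A -> Y) :
  pointed_map j -> pointed_map h -> h \o j = f ->
  homotopy_equivalence R (cone_exchange R j h f).
Proof.
move=> pj ph hj; have hjE a : h (j a) = f a by rewrite -hj.
have pf : pointed_map f by rewrite -hj; exact: pointed_comp.
have [pG Gb Gc] :=
  @mapcone_map_pointed R _ _ _ _ f h idfun j ph (@pointed_id Y) pj
    (fun a => esym (hjE a)).
have [pF Fb Fc] :=
  @mapcone_map_pointed R _ _ _ _ j idfun h f (@pointed_id Y) ph pf hjE.
exact: (square_exchange_equivalence pj pf ph (@pointed_id Y) pG pF Gb Gc Fb Fc).
Qed.
End Equivalences.

(** * The cone on a mapping cone *)

(* [fold_u, fold_v] send the edges [s = 0] and [t = 0] of the square onto the edge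
   [v = 0], and the edges [s = 1] and [t = 1] into the union of the three others;
   [unfold_s, unfold_t] push that edge back along the diagonal.  The truncation in
   [toI] keeps all coordinates in [I]. *)
Section Squares.
Context {R : realType}.
Local Notation I := (unitI R).

(** The factor [1 + 2 * min] is 1 on the edges [s = 0] and [t = 0], which are thus traversed
    linearly. On [s = 1] it gives [u >= 1] as long as [t <= 1/2], since [(1 - t) * (1 + 2 * t) >= 1]
    there, and from [t = 1/2] on [fold_v] has reached 1. The edge [t = 1] is symmetric. *)
Definition fold_u (s t : I) : I := toI R
  (2^-1 + (ival s - ival t) / 2 * (1 + 2 * Num.min (ival s) (ival t))).
Definition fold_v (s t : I) : I := toI R (2 * Num.min (ival s) (ival t)).
Definition unfold_s (u v : I) : I := toI R (Num.max 0 (2 * ival u - 1) + ival v).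
Definition unfold_t (u v : I) : I := toI R (Num.max 0 (1 - 2 * ival u) + ival v).

Lemma fold_s0 (t : I) :
  fold_u (toI R 0) t = toI R ((1 - ival t) / 2) /\ fold_v (toI R 0) t = toI R 0.
Proof.
rewrite /fold_u /fold_v ival0 (min_idPl (ival_ge0 t)).
by split; congr (toI R _); lra.
Qed.

Lemma fold_t0 (s : I) :
  fold_u s (toI R 0) = toI R ((1 + ival s) / 2) /\ fold_v s (toI R 0) = toI R 0.
Proof.
rewrite /fold_u /fold_v ival0 (min_idPr (ival_ge0 s)).
by split; congr (toI R _); lra.
Qed.

Lemma fold_s1 (t : I) :
  fold_u (toI R 1) t = toI R 1 \/ fold_v (toI R 1) t = toI R 1.
Proof.
have t0 := ival_ge0 t; have t1 := ival_le1 t.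
rewrite /fold_u /fold_v ival1 (min_idPr t1).
have [h|h] := lerP (ival t) 2^-1; [left|right]; apply: toI_ge1; last by lra.
by nra.
Qed.

Lemma fold_t1 (s : I) :
  fold_u s (toI R 1) = toI R 0 \/ fold_v s (toI R 1) = toI R 1.
Proof.
have s0 := ival_ge0 s; have s1 := ival_le1 s.
rewrite /fold_u /fold_v ival1 (min_idPl s1).
have [h|h] := lerP (ival s) 2^-1; [left|right]; [apply: toI_le0|apply: toI_ge1].
  by nra.
by lra.
Qed.

Lemma unfold_u0 (v : I) : unfold_t (toI R 0) v = toI R 1.
Proof.
apply: toI_ge1; rewrite ival0 mulr0 subr0 max_r ?ler01 //.
by have := ival_ge0 v; lra.
Qed.

Lemma unfold_u1 (v : I) : unfold_s (toI R 1) v = toI R 1.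
Proof.
apply: toI_ge1; rewrite ival1 max_r; first by have := ival_ge0 v; lra.
by lra.
Qed.

Lemma unfold_v1 (u : I) :
  unfold_s u (toI R 1) = toI R 1 /\ unfold_t u (toI R 1) = toI R 1.
Proof. by split; apply: toI_ge1; rewrite ival1 lerDr le_max lexx. Qed.

Lemma unfold_v0_le (u : I) : ival u <= 2^-1 ->
  unfold_s u (toI R 0) = toI R 0 /\ unfold_t u (toI R 0) = toI R (1 - 2 * ival u).
Proof.
move=> h; rewrite /unfold_s /unfold_t ival0 !addr0 max_l; last by lra.
by rewrite max_r //; lra.
Qed.

Lemma unfold_v0_ge (u : I) : 2^-1 <= ival u ->
  unfold_s u (toI R 0) = toI R (2 * ival u - 1) /\ unfold_t u (toI R 0) = toI R 0.
Proof.
move=> h; rewrite /unfold_s /unfold_t ival0 !addr0 max_r; last by lra.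
by rewrite max_l //; lra.
Qed.

Lemma fold_unfold_v_v0 (u : I) :
  fold_v (unfold_s u (toI R 0)) (unfold_t u (toI R 0)) = toI R 0.
Proof.
have [h|h] := lerP (ival u) 2^-1.
  by have [-> ->] := unfold_v0_le h; have [_ ->] := fold_s0 (toI R (1 - 2 * ival u)).
have [-> ->] := unfold_v0_ge (ltW h).
by have [_ ->] := fold_t0 (toI R (2 * ival u - 1)).
Qed.

Lemma fold_unfold_v_v1 (u : I) :
  fold_v (unfold_s u (toI R 1)) (unfold_t u (toI R 1)) = toI R 1.
Proof.
have [-> ->] := unfold_v1 u; rewrite /fold_v ival1 minxx mulr1.
by apply: toI_ge1; lra.
Qed.

Lemma fold_unfold_u_v0 (u : I) :
  fold_u (unfold_s u (toI R 0)) (unfold_t u (toI R 0)) = u.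
Proof.
have u0 := ival_ge0 u; have u1 := ival_le1 u.
have [h|h] := lerP (ival u) 2^-1.
  have [-> ->] := unfold_v0_le h; have [-> _] := fold_s0 (toI R (1 - 2 * ival u)).
  by rewrite toIK; [rewrite -[RHS]ivalK; congr (toI R _); lra|apply/andP; split; lra].
have [-> ->] := unfold_v0_ge (ltW h); have [-> _] := fold_t0 (toI R (2 * ival u - 1)).
by rewrite toIK; [rewrite -[RHS]ivalK; congr (toI R _); lra|apply/andP; split; lra].
Qed.

Lemma unfold_fold_s0 (t : I) (s := toI R 0) :
  unfold_s (fold_u s t) (fold_v s t) = s /\ unfold_t (fold_u s t) (fold_v s t) = t.
Proof.
have t0 := ival_ge0 t; have t1 := ival_le1 t.
rewrite /s; have [-> ->] := fold_s0 t.
have E : ival (toI R ((1 - ival t) / 2)) = (1 - ival t) / 2.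
  by apply: toIK; apply/andP; split; lra.
have [|-> ->] := @unfold_v0_le (toI R ((1 - ival t) / 2)); first by rewrite E; lra.
by split=> //; rewrite E -[RHS]ivalK; congr (toI R _); lra.
Qed.

Lemma unfold_fold_t0 (s : I) (t := toI R 0) :
  unfold_s (fold_u s t) (fold_v s t) = s /\ unfold_t (fold_u s t) (fold_v s t) = t.
Proof.
have s0 := ival_ge0 s; have s1 := ival_le1 s.
rewrite /t; have [-> ->] := fold_t0 s.
have E : ival (toI R ((1 + ival s) / 2)) = (1 + ival s) / 2.
  by apply: toIK; apply/andP; split; lra.
have [|-> ->] := @unfold_v0_ge (toI R ((1 + ival s) / 2)); first by rewrite E; lra.
by split=> //; rewrite E -[RHS]ivalK; congr (toI R _); lra.
Qed.

(** Only the coordinate [s] has to stay put: the whole edge represents the base point, so the motion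
    of [t] along it is invisible. *)
Lemma unfold_fold_s1 (t : I) (s := toI R 1) :
  unfold_s (fold_u s t) (fold_v s t) = s.
Proof.
rewrite /s; have [->|->] := fold_s1 t; first exact: unfold_u1.
by have [] := unfold_v1 (fold_u (toI R 1) t).
Qed.

Lemma unfold_fold_t1 (s : I) (t := toI R 1) :
  unfold_t (fold_u s t) (fold_v s t) = t.
Proof.
rewrite /t; have [->|->] := fold_t1 s; first exact: unfold_u0.
by have [] := unfold_v1 (fold_u s (toI R 1)).
Qed.

(** The square is convex, so its self-maps are deformed coordinatewise along segments. A gluing
    relation survives as soon as the coordinates it involves have equal ends, by [lerpxx]. *)
Definition lerp (a b r : I) : I := toI R ((1 - ival r) * ival a + ival r * ival b).

Lemma lerp0 (a b : I) : lerp a b (toI R 0) = a.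
Proof. by rewrite /lerp ival0 subr0 mul1r mul0r addr0 ivalK. Qed.

Lemma lerp1 (a b : I) : lerp a b (toI R 1) = b.
Proof. by rewrite /lerp ival1 subrr mul1r mul0r add0r ivalK. Qed.

Lemma lerpxx (a r : I) : lerp a a r = a.
Proof. by rewrite /lerp -mulrDl subrK mul1r ivalK. Qed.
End Squares.

Section Fold.
Context {R : realType}.
Local Notation I := (unitI R).
Local Notation "f ~ g" := (homotopic R f g) (at level 70).
Local Notation "x ∧ y" := (smash_pair x y) (at level 40, left associativity).
Context {X A Y : ptopologicalType} {f : X -> A} {k : mapcone R f -> Y}.
Context {l : A -> Y} {g : susp R 1 X -> mapcone R l}.
Context {J : mapcone R l -> mapcone R k}.
Hypotheses (pf : pointed_map f) (pk : pointed_map k) (pg : pointed_map g).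
Hypothesis kE : forall a, k (cone_base R f a) = l a.
Hypothesis gE1 : forall x u, ival u <= 2^-1 ->
  g (x ∧ tbar R u) = cone_pt R l (f x) (toI R (1 - 2 * ival u)).
Hypothesis gE2 : forall x u, 2^-1 <= ival u ->
  g (x ∧ tbar R u) = cone_base R l (k (cone_pt R f x (toI R (2 * ival u - 1)))).
Hypothesis pJ : pointed_map J.
Hypothesis JE1 : forall y, J (cone_base R l y) = cone_base R k y.
Hypothesis JE2 : forall a t, J (cone_pt R l a t) = cone_pt R k (cone_base R f a) t.

Let pl : pointed_map l.
Proof.
have -> : l = k \o cone_base R f by apply/funext => a /=; rewrite kE.
exact: pointed_comp (cone_base_pointed _).
Qed.

(** The part of the cone lying over [A] already belongs to the mapping cone of [l] and is left
    alone; only the squares over [X] are reshaped. *)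
Definition fold_map : mapcone R k -> mapcone R g :=
  mapcone_rec R (fun y => cone_base R g (cone_base R l y))
    (fun c t => mapcone_rec R (fun a => cone_base R g (cone_pt R l a t))
      (fun x s => cone_pt R g (x ∧ tbar R (fold_u s t)) (fold_v s t)) c).

Lemma fold_map_pointed : [/\ pointed_map fold_map,
  (forall y, fold_map (cone_base R k y) = cone_base R g (cone_base R l y)),
  (forall a t, fold_map (cone_pt R k (cone_base R f a) t) =
     cone_base R g (cone_pt R l a t)) &
  (forall x s t, fold_map (cone_pt R k (cone_pt R f x s) t) =
     cone_pt R g (x ∧ tbar R (fold_u s t)) (fold_v s t))].
Proof.
have [_ fp] := pf; have [_ kp] := pk; have [_ gp] := pg; have [_ lp] := pl.
have [|||||x t|cv vE1 vE2] := @mapcone_rec_param R _ _ _ f I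
  (fun a t => cone_base R g (cone_pt R l a t))
  (fun x s t => cone_pt R g (x ∧ tbar R (fold_u s t)) (fold_v s t)) (@unitI_based R).
- by cts.
- by rewrite /fold_u /fold_v; cts.
- by move=> t; rewrite (@cone_pt_pointl R _ _ l).
- by move=> s t; rewrite smash_pointl cone_pt_pointl.
(* The edge [s = 1] may land on [u = 1] or on [v = 1]; both are the base point of the target. *)
- move=> x t; have [->|->] := fold_s1 t; last by rewrite cone_pt1.
  by rewrite tbar_1 smash_pointr cone_pt_pointl.
(* Here [v = 0] and [u = (1 - t) / 2 <= 1/2], so the first half of [g] applies, and its cone
   parameter [1 - 2 * u] is [t] again. *)
- have [-> ->] := fold_s0 t; rewrite cone_pt0.
  have t0 := ival_ge0 t; have t1 := ival_le1 t.
  have E : ival (toI R ((1 - ival t) / 2)) = (1 - ival t) / 2.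
    by apply: toIK; apply/andP; split; lra.
  rewrite gE1 E; last by lra.
  by congr (cone_base R g (cone_pt R l _ _)); rewrite -[RHS]ivalK; congr (toI R _); lra.
have [|||t|c|c|px xE1 xE2] := @mapcone_rec_pointed R _ _ _ k
  (fun y => cone_base R g (cone_base R l y))
  (fun c t => mapcone_rec R (fun a => cone_base R g (cone_pt R l a t))
      (fun x s => cone_pt R g (x ∧ tbar R (fold_u s t)) (fold_v s t)) c).
- by cts.
- exact: cv.
- exact: etrans (congr1 (cone_base R g) (cone_base_point l)) (cone_base_point g).
- by rewrite -(cone_base_point f) vE1 (@cone_pt_pointl R _ _ l).
- move: c; apply: mapcone_ind => [a|x s]; first by rewrite vE1 (@cone_pt1 R _ _ l).
  rewrite vE2; have [->|->] := fold_t1 s; last by rewrite cone_pt1.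
  by rewrite tbar_0 smash_pointr cone_pt_pointl.
- move: c; apply: mapcone_ind => [a|x s]; first by rewrite vE1 kE cone_pt0.
  (* Symmetrically, [u = (1 + s) / 2] falls in the second half of [g], where [2 * u - 1] is [s]. *)
  rewrite vE2; have [-> ->] := fold_t0 s; rewrite cone_pt0.
  have s0 := ival_ge0 s; have s1 := ival_le1 s.
  have E : ival (toI R ((1 + ival s) / 2)) = (1 + ival s) / 2.
    by apply: toIK; apply/andP; split; lra.
  rewrite gE2 E; last by lra.
  congr (cone_base R g (cone_base R l (k (cone_pt R f _ _)))).
  by rewrite -[RHS]ivalK; congr (toI R _); lra.
by rewrite /fold_map; split=> // *; rewrite xE2 ?vE1 ?vE2.
Qed.

Definition unfold_map : mapcone R g -> mapcone R k :=
  mapcone_rec R J (fun q v => susp1_rec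
    (fun x u => cone_pt R k (cone_pt R f x (unfold_s u v)) (unfold_t u v)) q).

Lemma unfold_map_pointed : [/\ pointed_map unfold_map,
  (forall c, unfold_map (cone_base R g c) = J c) &
  (forall x u v, unfold_map (cone_pt R g (x ∧ tbar R u) v) =
     cone_pt R k (cone_pt R f x (unfold_s u v)) (unfold_t u v))].
Proof.
have [_ fp] := pf; have [_ kp] := pk; have [_ gp] := pg; have [cJ Jp] := pJ.
have [||||cv vE] := @susp1_rec_param R X _ I
  (fun x u v => cone_pt R k (cone_pt R f x (unfold_s u v)) (unfold_t u v)) (@unitI_based R).
- by rewrite /unfold_s /unfold_t; cts.
- by move=> u v; rewrite (@cone_pt_pointl R _ _ f) // cone_pt_pointl.
- by move=> x v; rewrite unfold_u0 cone_pt1.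
- by move=> x v; rewrite unfold_u1 (@cone_pt1 R _ _ f) // cone_pt_pointl.
have [|||v|q|q|px xE1 xE2] := @mapcone_rec_pointed R _ _ _ g J (fun q v => susp1_rec
    (fun x u => cone_pt R k (cone_pt R f x (unfold_s u v)) (unfold_t u v)) q).
- exact: cJ.
- exact: cv.
- exact: Jp.
- rewrite -(@smash_pointl X (circle R) (tbar R (toI R 0))) vE.
  by rewrite (@cone_pt_pointl R _ _ f) // cone_pt_pointl.
- move: q; apply: susp1_ind => x u; rewrite vE.
  by have [-> ->] := unfold_v1 u; rewrite cone_pt1.
- move: q; apply: susp1_ind => x u; rewrite vE.
  have [h|h] := lerP (ival u) 2^-1.
    by have [-> ->] := unfold_v0_le h; rewrite gE1 // JE2 cone_pt0.
  by have [-> ->] := unfold_v0_ge (ltW h); rewrite gE2 ?ltW // JE1 cone_pt0.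
by rewrite /unfold_map; split=> // *; rewrite xE2 vE.
Qed.

(** Both coordinates move at once along a segment. This respects the gluings because the composite
    fixes the edges [s = 0] and [t = 0] pointwise and keeps each of the other two edges within
    itself. *)
Lemma unfold_fold_homotopic : unfold_map \o fold_map ~ idfun.
Proof.
have [_ fp] := pf; have [_ kp] := pk.
have [[cF Fp] F1 F2 F3] := fold_map_pointed; have [pU U1 U2] := unfold_map_pointed.
pose S s t := unfold_s (fold_u s t) (fold_v s t) : I.
pose T s t := unfold_t (fold_u s t) (fold_v s t) : I.
(* The parameter [p] pairs the outer cone coordinate with the time of the homotopy. *)
have [|||||x p|cv vE1 vE2] := @mapcone_rec_param R _ _ _ f (I * I)%type
  (fun a p => cone_pt R k (cone_base R f a) p.1)
  (fun x s p => cone_pt R k (cone_pt R f x (lerp (S s p.1) s p.2))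
     (lerp (T s p.1) p.1 p.2)) (compactly_based_prod (@unitI_based R) (@unitI_based R)).
- by cts.
- by rewrite /S /T /lerp /unfold_s /unfold_t /fold_u /fold_v; cts.
- by move=> p; rewrite (@cone_base_point R _ _ f) cone_pt_pointl.
- by move=> s p; rewrite (@cone_pt_pointl R _ _ f) // cone_pt_pointl.
- move=> x p; rewrite /S unfold_fold_s1 lerpxx (@cone_pt1 R _ _ f) //.
  by rewrite cone_pt_pointl.
- by rewrite /S /T; have [-> ->] := unfold_fold_s0 p.1; rewrite !lerpxx cone_pt0.
pose c (q : mapcone R f) (t r : I) := mapcone_rec R
  (fun a => cone_pt R k (cone_base R f a) t)
  (fun x s => cone_pt R k (cone_pt R f x (lerp (S s t) s r)) (lerp (T s t) t r)) q.
have c1 a t r : c (cone_base R f a) t r = cone_pt R k (cone_base R f a) t := vE1 a (t, r).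
have c2 x s t r : c (cone_pt R f x s) t r =
  cone_pt R k (cone_pt R f x (lerp (S s t) s r)) (lerp (T s t) t r) := vE2 x s (t, r).
apply: (@mapcone_homotopic R _ _ _ _ _ _ (fun y _ => cone_base R k y) c).
- by cts.
- exact: cv.
- by move=> t; exact: cone_base_point.
- by move=> t r; rewrite -(cone_base_point f) c1 (@cone_base_point R _ _ f) cone_pt_pointl.
- move=> q r; move: q; apply: mapcone_ind => [a|x s]; first by rewrite c1 cone_pt1.
  by rewrite c2 /T unfold_fold_t1 lerpxx cone_pt1.
- move=> q r; move: q; apply: mapcone_ind => [a|x s]; first by rewrite c1 cone_pt0.
  by rewrite c2 /S /T; have [-> ->] := unfold_fold_t0 s; rewrite !lerpxx cone_pt0.
- by move=> y /=; rewrite F1 U1 JE1.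
- move=> q t; move: q; apply: mapcone_ind => [a|x s] /=.
    by rewrite c1 F2 U1 JE2.
  by rewrite c2 !lerp0 F3 U2.
- by [].
- by apply: mapcone_ind => [a|x s] t; rewrite ?c1 ?c2 ?lerp1.
Qed.

Lemma fold_unfold_homotopic : fold_map \o unfold_map ~ idfun.
Proof.
have [_ gp] := pg.
have [pF F1 F2 F3] := fold_map_pointed; have [pU U1 U2] := unfold_map_pointed.
pose U u v := fold_u (unfold_s u v) (unfold_t u v) : I.
pose V u v := fold_v (unfold_s u v) (unfold_t u v) : I.
have FJ c : fold_map (J c) = cone_base R g c.
  by move: c; apply: mapcone_ind => [y|a t]; [rewrite JE1 F1|rewrite JE2 F2].
(* The cone coordinate is moved first: on the edges [u = 0] and [u = 1] the
   suspension coordinate may only move once the cone coordinate has reached 1. *)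
pose d := mapcone_rec R (cone_base R g) (fun q v => susp1_rec
    (fun x u => cone_pt R g (x ∧ tbar R u) (V u v)) q) : mapcone R g -> mapcone R g.
have [||||cd dE] := @susp1_rec_param R X _ I
  (fun x u v => cone_pt R g (x ∧ tbar R u) (V u v)) (@unitI_based R).
- by rewrite /V /fold_v /unfold_s /unfold_t; cts.
- by move=> u v; rewrite smash_pointl cone_pt_pointl.
- by move=> x v; rewrite tbar_0 smash_pointr cone_pt_pointl.
- by move=> x v; rewrite tbar_1 smash_pointr cone_pt_pointl.
have [|||v|q|q|pd d1 d2] := @mapcone_rec_pointed R _ _ _ g (cone_base R g) (fun q v => susp1_rec
    (fun x u => cone_pt R g (x ∧ tbar R u) (V u v)) q).
- by cts.
- exact: cd.
- exact: cone_base_point.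
- by rewrite -(@smash_pointl X (circle R) (tbar R (toI R 0))) dE smash_pointl cone_pt_pointl.
- by move: q; apply: susp1_ind => x u; rewrite dE /V fold_unfold_v_v1 cone_pt1.
- by move: q; apply: susp1_ind => x u; rewrite dE /V fold_unfold_v_v0 cone_pt0.
rewrite -/d in pd d1 d2.
have {}d2 x u v : d (cone_pt R g (x ∧ tbar R u) v) = cone_pt R g (x ∧ tbar R u) (V u v).
  by rewrite d2 dE.
apply: (@homotopic_trans R _ _ _ d).
- apply: homotopic_sym.
  have [||||cv vE] := @susp1_rec_param R X _ (I * I)%type
    (fun x u p => cone_pt R g (x ∧ tbar R (lerp u (U u p.1) p.2)) (V u p.1))
    (compactly_based_prod (@unitI_based R) (@unitI_based R)).
  + by rewrite /U /V /lerp /fold_u /fold_v /unfold_s /unfold_t; cts.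
  + by move=> u p; rewrite smash_pointl cone_pt_pointl.
  (* For [u = 0] the unfolded point has [t = 1]. Folding sends it either to [u = 0], so that the
     segment is constant, or to [v = 1], the base point. *)
  + move=> x p; rewrite /U /V unfold_u0.
    have [->|->] := fold_t1 (unfold_s (toI R 0) p.1); last by rewrite cone_pt1.
    by rewrite lerpxx tbar_0 smash_pointr cone_pt_pointl.
  + move=> x p; rewrite /U /V unfold_u1.
    have [->|->] := fold_s1 (unfold_t (toI R 1) p.1); last by rewrite cone_pt1.
    by rewrite lerpxx tbar_1 smash_pointr cone_pt_pointl.
  pose c (q : susp R 1 X) (v r : I) := susp1_rec
    (fun x u => cone_pt R g (x ∧ tbar R (lerp u (U u v) r)) (V u v)) q.
  have cE x u v r : c (x ∧ tbar R u) v r =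
    cone_pt R g (x ∧ tbar R (lerp u (U u v) r)) (V u v) := vE x u (v, r).
  apply: (@mapcone_homotopic R _ _ _ _ _ _ (fun y _ => cone_base R g y) c).
  + by cts.
  + exact: cv.
  + by move=> t; exact: cone_base_point.
  + move=> v r; rewrite -(@smash_pointl X (circle R) (tbar R (toI R 0))) cE.
    by rewrite smash_pointl cone_pt_pointl.
  + move=> q r; move: q; apply: susp1_ind => x u.
    by rewrite cE /V fold_unfold_v_v1 cone_pt1.
  (* On the edge [v = 0], where the cone is attached by [g], folding undoes unfolding exactly, so
     nothing moves. *)
  + move=> q r; move: q; apply: susp1_ind => x u.
    by rewrite cE /U /V fold_unfold_v_v0 fold_unfold_u_v0 lerpxx cone_pt0.
  + by move=> y; rewrite d1.
  + by apply: susp1_ind => x u v; rewrite cE d2 lerp0.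
  + by move=> y /=; rewrite U1 FJ.
  + by apply: susp1_ind => x u v /=; rewrite cE U2 F3 lerp1.
- have [||||cv vE] := @susp1_rec_param R X _ (I * I)%type
    (fun x u p => cone_pt R g (x ∧ tbar R u) (lerp p.1 (V u p.1) p.2))
    (compactly_based_prod (@unitI_based R) (@unitI_based R)).
  + by rewrite /V /lerp /fold_v /unfold_s /unfold_t; cts.
  + by move=> u p; rewrite smash_pointl cone_pt_pointl.
  + by move=> x p; rewrite tbar_0 smash_pointr cone_pt_pointl.
  + by move=> x p; rewrite tbar_1 smash_pointr cone_pt_pointl.
  pose c (q : susp R 1 X) (v r : I) := susp1_rec
    (fun x u => cone_pt R g (x ∧ tbar R u) (lerp v (V u v) r)) q.
  have cE x u v r : c (x ∧ tbar R u) v r =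
    cone_pt R g (x ∧ tbar R u) (lerp v (V u v) r) := vE x u (v, r).
  apply: homotopic_sym.
  apply: (@mapcone_homotopic R _ _ _ _ _ _ (fun y _ => cone_base R g y) c).
  + by cts.
  + exact: cv.
  + by move=> t; exact: cone_base_point.
  + move=> v r; rewrite -(@smash_pointl X (circle R) (tbar R (toI R 0))) cE.
    by rewrite smash_pointl cone_pt_pointl.
  + move=> q r; move: q; apply: susp1_ind => x u.
    by rewrite cE /V fold_unfold_v_v1 lerpxx cone_pt1.
  + move=> q r; move: q; apply: susp1_ind => x u.
    by rewrite cE /V fold_unfold_v_v0 lerpxx cone_pt0.
  + by [].
  + by apply: susp1_ind => x u v; rewrite cE lerp0.
  + by move=> y; rewrite d1.
  + by apply: susp1_ind => x u v; rewrite cE d2 lerp1.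
Qed.

(** The strict equation holds because folding fixes the mapping cone of [l]; it becomes the
    condition on [a32]. *)
Lemma fold_map_equivalence : homotopy_equivalence R fold_map /\
  fold_map \o J = cone_base R g.
Proof.
have [pF F1 F2 F3] := fold_map_pointed; have [pU U1 U2] := unfold_map_pointed.
split.
  split=> //; exists unfold_map; split=> //.
    exact: unfold_fold_homotopic.
  exact: fold_unfold_homotopic.
apply/funext => c /=; move: c.
by apply: mapcone_ind => [y|a t]; [rewrite JE1 F1|rewrite JE2 F2].
Qed.
End Fold.

(** * The brackets *)

Section SuspOmega.
Context {R : realType} (m : nat) {X Y : ptopologicalType} (f : X -> Y).
Hypothesis pf : pointed_map f.
Local Notation I := (unitI R).
Local Notation "x ∧ y" := (smash_pair x y) (at level 40, left associativity).
Local Notation sf := (smap R m f).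
Local Notation sj := (smap R m (cone_base R f)).

Let psf : pointed_map sf. Proof. by have [] := @smap_pointed R m _ _ _ pf. Qed.
Let psj : pointed_map sj.
Proof. by have [] := @smap_pointed R m _ _ _ (@cone_base_pointed R _ _ f). Qed.

Lemma psi_cone_base y : psi R m f (cone_base R sf y) = sj y.
Proof.
have [_ E _] := @psi_pointed R m _ _ _ pf.
have [_ jE] := @smap_pointed R m _ _ _ (@cone_base_pointed R _ _ f).
by move: y; apply: smash_ind => y s; rewrite E jE.
Qed.

Lemma psi_inv_cone_base y : @psi_inv R m _ _ f (sj y) = cone_base R sf y.
Proof. by rewrite -psi_cone_base psiK. Qed.

(** The coextension of the suspended map, carried to the suspended cone by [psi]. *)
Definition susp_omega_inv : susp R 1 (susp R m X) -> mapcone R sj :=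
  (mapcone_map R (psi R m f) idfun : mapcone R (cone_base R sf) -> mapcone R sj)
    \o qprime_inv sf.

(** The switch undoes the permutation of coordinates built into [psi], so up to a homeomorphism the
    suspended [qprime] is the [qprime] of the suspended map. *)
Lemma susp_omegaE : susp_omega R m (qprime R f) = qprime R sf \o
  (mapcone_map R (@psi_inv R m _ _ f) idfun : mapcone R sj -> mapcone R (cone_base R sf)).
Proof.
have [pq q1 q2] := @qprime_pointed R _ _ f.
have [psq qE] := @smap_pointed R m _ _ _ pq.
have [pp p1 p2] := @pinch_pointed R _ _ f.
have [_ ps1 ps2] := @psi_pointed R m _ _ _ (@cone_base_pointed R _ _ f).
have [[_ sw0] swE] := @switch_pointed X (circle R) (sphere R m) (@sphere_based R m).
have [_ Q1 Q2] := @qprime_pointed R _ _ sf.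
have [_ P1 P2] := @pinch_pointed R _ _ sf.
have [pI I1 I2] := @psi_inv_pointed R m _ _ _ pf.
have [_ M1 M2] := @mapcone_map_pointed R _ _ _ _ sj (cone_base R sf) (@psi_inv R m _ _ f) idfun
  (@cone_base_pointed R _ _ sf) pI (@pointed_id _) psi_inv_cone_base.
apply/funext; apply: mapcone_ind => [|u t]; rewrite /susp_omega /=.
  apply: smash_ind => c s; rewrite ps1 qE q1 M1 Q1; move: c.
  apply: mapcone_ind => [y|x t]; first by rewrite p1 I1 P1 smash_pointl sw0.
  by rewrite p2 I2 P2 swE.
by rewrite M2 Q2; move: u; apply: smash_ind => y s; rewrite ps2 qE q2 smash_pointl sw0.
Qed.

Lemma susp_omega_inverse :
  pointed_map (susp_omega R m (qprime R f)) /\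
  homotopy_inverse R (susp_omega R m (qprime R f)) susp_omega_inv.
Proof.
have [pI _ _] := @psi_inv_pointed R m _ _ _ pf; have [pP _ _] := @psi_pointed R m _ _ _ pf.
have [pM _ _] := @mapcone_map_pointed R _ _ _ _ sj (cone_base R sf) (@psi_inv R m _ _ f) idfun
  (@cone_base_pointed R _ _ sf) pI (@pointed_id _) psi_inv_cone_base.
have [pN _ _] := @mapcone_map_pointed R _ _ _ _ (cone_base R sf) sj (psi R m f) idfun
  psj pP (@pointed_id _) psi_cone_base.
have [pQ _ _] := @qprime_pointed R _ _ sf.
rewrite susp_omegaE; split; first exact: pointed_comp.
apply: homotopy_inverse_comp => //; last exact: qprime_inverse.
apply: homeo_homotopy_inverse => //.
  apply: (mapcone_map_cancel psj (@cone_base_pointed R _ _ sf) pI (@pointed_id _)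
    pP (@pointed_id _) psi_inv_cone_base psi_cone_base) => //.
  exact: psi_invK.
apply: (mapcone_map_cancel (@cone_base_pointed R _ _ sf) psj pP (@pointed_id _)
    pI (@pointed_id _) psi_cone_base psi_inv_cone_base) => //.
exact: psiK.
Qed.

Lemma susp_omega_invE x u : susp_omega_inv (x ∧ tbar R u) =
  if ival u <= 2^-1 then cone_pt R sj (sf x) (toI R (1 - 2 * ival u))
  else cone_base R sj (psi R m f (cone_pt R sf x (toI R (2 * ival u - 1)))).
Proof.
have [pP _ _] := @psi_pointed R m _ _ _ pf.
have [pN N1 N2] := @mapcone_map_pointed R _ _ _ _ (cone_base R sf) sj (psi R m f) idfun
  psj pP (@pointed_id _) psi_cone_base.
have [_ cE] := coextension_pointed (@cone_base_pointed R _ _ sf) psf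
  (cone_null_homotopyP psf).
by rewrite /susp_omega_inv /= /qprime_inv cE; case: ifP => _; rewrite ?N1 ?N2.
Qed.
End SuspOmega.

Section Brackets.
Context {R : realType} {X1 X2 X3 X4 : ptopologicalType} {m1 m2 m3 : nat}.
Context (f3 : susp R m3 X3 -> X4) (f2 : susp R m2 X2 -> X3) (f1 : susp R m1 X1 -> X2).
Hypotheses (pf1 : pointed_map f1) (pf2 : pointed_map f2) (pf3 : pointed_map f3).
Local Notation I := (unitI R).
Local Notation "f ~ g" := (homotopic R f g) (at level 70).
Local Notation "x ∧ y" := (smash_pair x y) (at level 40, left associativity).
Local Notation data := (bracket_data R f3 f2 f1).
Local Notation f2bar := (f2bar R f3 f2 f1).
Local Notation f3bar := (f3bar R f3 f2 f1).
Local Notation g32 := (g32 R f3 f2 f1).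
Local Notation bracket_map := (bracket_map R f3 f2 f1).
Local Notation sf1 := (smap R m2 f1).
Local Notation sj21 := (smap R m2 (j21 R f1)).

Let psf1 : pointed_map sf1. Proof. by have [] := @smap_pointed R m2 _ _ _ pf1. Qed.
Let psf2 : pointed_map (smap R m3 f2).
Proof. by have [] := @smap_pointed R m3 _ _ _ pf2. Qed.
Let psj : pointed_map sj21.
Proof. by have [] := @smap_pointed R m2 _ _ _ (@cone_base_pointed R _ _ f1). Qed.

(** Parametrised by the extensions rather than by given data, since the passage from Toda's bracket
    starts from extensions made out of null homotopies. *)
Definition with_susp_omega_inv (h : susp R m2 (C22 R f1) -> X3)
    (ph : pointed_map h) (hE : h \o sj21 = f2)
    (k : susp R m3 (C32 R f2) -> X4) (pk : pointed_map k)
    (kE : k \o smap R m3 (j31 R f2) = f3) : data :=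
  Build_bracket_data R f3 f2 f1 h ph hE (@susp_omega_inv R m2 _ _ f1)
    (proj2 (@susp_omega_inverse R m2 _ _ _ pf1)) k pk kE.

Definition canonical (d : data) : data :=
  with_susp_omega_inv (f2bar_map _ _ _ _ d) (f2barE _ _ _ _ d)
    (f3bar_map _ _ _ _ d) (f3barE _ _ _ _ d).

Let h_pointed (h : susp R m2 (C22 R f1) -> X3) (ph : pointed_map h)
    (hE : h \o sj21 = f2) :
  [/\ pointed_map (mapcone_map R h idfun : mapcone R sj21 -> mapcone R f2),
      (forall y, (mapcone_map R h idfun : mapcone R sj21 -> mapcone R f2)
         (cone_base R sj21 y) = cone_base R f2 (h y)) &
      (forall x t, (mapcone_map R h idfun : mapcone R sj21 -> mapcone R f2)
         (cone_pt R sj21 x t) = cone_pt R f2 x t)].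
Proof.
apply: mapcone_map_pointed => //; first exact: pointed_id.
by move=> x; rewrite -hE.
Qed.

Lemma bracket_map_canonical d : bracket_map d ~ bracket_map (canonical d).
Proof.
have [ph _ _] := h_pointed (f2bar_map _ _ _ _ d) (f2barE _ _ _ _ d).
have [psw _] :=
  @switch_pointed (susp R m2 (susp R m1 X1)) (sphere R m3) (circle R)
    (@sphere_based R 1).
apply: homotopic_compr psw _; apply: homotopic_compl (f3bar_map _ _ _ _ d) _.
apply: smap_homotopic; apply: (homotopic_compl ph).
apply: (homotopy_inverse_unique (susp_omega21_invP _ _ _ _ d)).
exact: (proj2 (@susp_omega_inverse R m2 _ _ _ pf1)).
Qed.

Section Canonical.
Context (h : susp R m2 (C22 R f1) -> X3) (ph : pointed_map h) (hE : h \o sj21 = f2).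
Context (k : susp R m3 (C32 R f2) -> X4) (pk : pointed_map k).
Context (kE : k \o smap R m3 (j31 R f2) = f3).
Let d : data := with_susp_omega_inv ph hE pk kE.

Lemma g32_canonical x u : g32 d (x ∧ tbar R u) =
  if ival u <= 2^-1 then cone_pt R f2 (sf1 x) (toI R (1 - 2 * ival u))
  else cone_base R f2 (h (psi R m2 f1 (cone_pt R sf1 x (toI R (2 * ival u - 1))))).
Proof.
have [_ h1 h2] := h_pointed ph hE.
rewrite /Defs.g32 /= (@susp_omega_invE R m2 _ _ _ pf1).
by case: ifP => _; [exact: h2|exact: h1].
Qed.

(** An equality of functions, with no homotopy involved: the final [switch] moves the sphere
    coordinate past the circle coordinate, as the coextension on the suspended source requires. *)
Lemma bracket_map_toda A2 A1 :
  null_homotopy R (f3 \o smap R m3 f2) A2 -> null_homotopy R (f2 \o sf1) A1 ->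
  (forall u t, k (psi R m3 f2 (cone_pt R _ u t)) = A2 (u, t)) ->
  (forall x t, h (psi R m2 f1 (cone_pt R _ x t)) = A1 (x, t)) ->
  bracket_map d = extension R f3 A2 (smap R m3 f2) \o
    coextension R (smap R m3 f2) (susp_homotopy R m3 A1) (smap R m3 sf1).
Proof.
move=> nA2 nA1 kA2 hA1.
have [_ gp] : pointed_map (g32 d).
  have [phm _ _] := h_pointed ph hE.
  apply: pointed_comp phm _.
  by have [] := proj2 (@susp_omega_inverse R m2 _ _ _ pf1).
have gE x s : smap R m3 (g32 d) (x ∧ s) = g32 d x ∧ s.
  apply: (smash_recE _ point) => [y|y]; rewrite ?smash_pointr //.
  by rewrite gp smash_pointl.
have [_ swE] :=
  @switch_pointed (susp R m2 (susp R m1 X1)) (sphere R m3) (circle R)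
    (@sphere_based R 1).
have [_ psb psc] := @psi_pointed R m3 _ _ _ pf2.
have [cf3 f3p] := pf3; have [cA2 A20 A21 A2p] := nA2; have [cA1 A10 A11 A1p] := nA1.
have [|||||| _ e1 e2] := @mapcone_rec_pointed R _ _ _ (smap R m3 f2) f3 (fun u t => A2 (u, t)).
- exact: cf3.
- by apply: (continuous_comp_fun cA2); cts.
- exact: f3p.
- exact: A2p.
- exact: A21.
- exact: A20.
have [||| cH HE] := @smash_rec_param _ _ _ I
  (fun (x : susp R m2 (susp R m1 X1)) (s : sphere R m3) t => A1 (x, t) ∧ s)
  (@unitI_based R).
- by cts; apply: (continuous_comp_fun cA1); cts.
- by move=> s t; rewrite A1p smash_pointl.
- by move=> x t; rewrite smash_pointr.
have [_ sfE] := @smap_pointed R m3 _ _ _ psf1.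
have [_ sf2E] := @smap_pointed R m3 _ _ _ pf2.
have nH : null_homotopy R (smap R m3 f2 \o smap R m3 sf1) (susp_homotopy R m3 A1).
  split.
  - exact: cH.
  - by apply: smash_ind => x s; rewrite /susp_homotopy HE /= sfE sf2E A10.
  - by apply: smash_ind => x s; rewrite /susp_homotopy HE A11 smash_pointl.
  - move=> t; rewrite /susp_homotopy -(smash_pointl _ (point : sphere R m3)) HE.
    by rewrite A1p smash_pointl.
have [psf1' _] := @smap_pointed R m3 _ _ _ psf1.
have [_ cE] := coextension_pointed psf2 psf1' nH.
apply/funext; apply: susp1_ind => z u; move: z; apply: smash_ind => x s.
rewrite /Defs.bracket_map /= swE gE g32_canonical cE.
(* On the first half both sides lie on the cone and give [A2]. On the second half both lie on the
   base, where [k] restricts to [f3]. *)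
case: ifP => _.
  by rewrite sfE /extension e2 -kA2 psc.
rewrite /extension e1 /susp_homotopy /= HE -hA1 -kE /=.
by rewrite (proj2 (@smap_pointed R m3 _ _ _ (@cone_base_pointed R _ _ f2))).
Qed.

(** Transporting [h] along [psi] turns the cone on a suspended mapping cone into the cone on the
    mapping cone of the suspended [f1], to which folding applies. *)
Lemma canonical_a32 : exists a : C33 R f1 h -> mapcone R (g32 d),
  homotopy_equivalence R a /\ a \o j32 R f2 f1 h = cone_base R (g32 d).
Proof.
have [pP _ _] := @psi_pointed R m2 _ _ _ pf1.
have [pI _ _] := @psi_inv_pointed R m2 _ _ _ pf1.
(* This [l] takes the place of [k] in the folding construction, where [f2] takes the place of
   [l]. *)
pose l := h \o psi R m2 f1.
have pl : pointed_map l by exact: pointed_comp.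
have hp x : idfun (h x) = l (@psi_inv R m2 _ _ f1 x) by rewrite /l /= psi_invK.
have ph' x : idfun (l x) = h (psi R m2 f1 x) by [].
have [pE E1 E2] :=
  @mapcone_map_pointed R _ _ _ _ h l idfun (@psi_inv R m2 _ _ f1)
    pl (@pointed_id _) pI hp.
have [pE' E1' E2'] :=
  @mapcone_map_pointed R _ _ _ _ l h idfun (psi R m2 f1) ph (@pointed_id _) pP ph'.
have lE a : l (cone_base R sf1 a) = f2 a.
  by rewrite /l /= (@psi_cone_base R m2 _ _ _ pf1) -hE.
have pg : pointed_map (g32 d).
  have [phm _ _] := h_pointed ph hE.
  apply: pointed_comp phm _.
  by have [] := proj2 (@susp_omega_inverse R m2 _ _ _ pf1).
have g1 x u : ival u <= 2^-1 ->
    g32 d (x ∧ tbar R u) = cone_pt R f2 (sf1 x) (toI R (1 - 2 * ival u)).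
  by move=> h12; rewrite g32_canonical h12.
have g2 x u : 2^-1 <= ival u -> g32 d (x ∧ tbar R u) =
    cone_base R f2 (l (cone_pt R sf1 x (toI R (2 * ival u - 1)))).
  (* At the common value [u = 1/2] the conditional picks the first branch; the two branches agree
     there by the gluing. *)
  move=> h12; rewrite g32_canonical; case: ifP => // h21.
  have -> : ival u = 2^-1 by lra.
  by rewrite mulfV ?pnatr_eq0 // subrr !cone_pt0 lE.
have [pJ J1 J2] := @mapcone_map_pointed R _ _ _ _ f2 l idfun (cone_base R sf1) pl
  (@pointed_id _) (@cone_base_pointed R _ _ sf1) (fun a => esym (lE a)).
have [eq_a aJ] := fold_map_equivalence psf1 pl pg lE g1 g2 pJ J1 J2.
exists (fold_map \o (mapcone_map R idfun (@psi_inv R m2 _ _ f1) : mapcone R h -> mapcone R l)).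
split.
  apply: homotopy_equivalence_comp eq_a; split=> //.
  exists (mapcone_map R idfun (psi R m2 f1)); apply: homeo_homotopy_inverse => //.
    by apply: (mapcone_map_cancel ph pl (@pointed_id _) pI (@pointed_id _) pP hp ph') => //;
      exact: psi_invK.
  by apply: (mapcone_map_cancel pl ph (@pointed_id _) pP (@pointed_id _) pI ph' hp) => //;
    exact: psiK.
rewrite -aJ; apply/funext => c /=; congr (fold_map _).
have hj a : idfun (f2 a) = h (sj21 a) by rewrite -hE.
have [_ j1 j2] := @mapcone_map_pointed R _ _ _ _ f2 h idfun sj21 ph (@pointed_id _) psj hj.
move: c; apply: mapcone_ind => [y|a t]; first by rewrite /j32 j1 E1 J1.
by rewrite /j32 j2 E2 J2 (@psi_inv_cone_base R m2 _ _ _ pf1).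
Qed.
End Canonical.

Lemma omega21_equivalence : homotopy_equivalence R (omega21 R f1).
Proof. exact: qprime_equivalence. Qed.

Lemma omega31_equivalence : homotopy_equivalence R (omega31 R f2).
Proof. exact: qprime_equivalence. Qed.

(** Each of the three factors is an equivalence: the exchange is a homeomorphism, the pinch
    collapses the contractible cone on [X3], and the last map is the suspension of an
    equivalence. *)
Lemma omega32_equivalence d : homotopy_equivalence R (omega32 R f3 f2 f1 d).
Proof.
have ph := f2bar_map _ _ _ _ d; have hE := f2barE _ _ _ _ d.
apply: (homotopy_equivalence_comp (f := cone_exchange R sj21 (f2bar d) f2)).
  exact: cone_exchange_equivalence.
apply: (homotopy_equivalence_comp (f := pinch R)).
  have [K nK] := @cone_contraction R X3.
  have hj a : f2bar d (sj21 a) = idfun (f2 a) := congr1 (fun F => F a) hE.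
  have [pF _ _] := @mapcone_map_pointed R _ _ _ _ sj21 idfun (f2bar d) f2
    (@pointed_id _) ph pf2 hj.
  exact: (pinch_equivalence pF nK).
apply: smap_equivalence; have [po ho] := @susp_omega_inverse R m2 _ _ _ pf1.
by split; [exact: po|exists (@susp_omega_inv R m2 _ _ f1)].
Qed.

Lemma st_bracket_eq : st_bracket R f3 f2 f1 =
  [set hclass R (bracket_map d) | d in [set: data]].
Proof.
apply/seteqP; split=> _ [d _ <-]; first by exists (st_data _ _ _ _ d).
(* The presentation is built on [canonical d] rather than on [d]: its [g32] may differ, but its
   bracket map has the same homotopy class. *)
have [a [ea aj]] := canonical_a32 (f2bar_map _ _ _ _ d) (f2barE _ _ _ _ d)
  (f3bar_map _ _ _ _ d) (f3barE _ _ _ _ d).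
exists (@Build_st_presentation R _ _ _ _ _ _ _ f3 f2 f1 (canonical d) a ea aj) => //.
by apply: esym; apply: hclass_eq; exact: bracket_map_canonical.
Qed.

Lemma aqs2_bracket_eq : aqs2_bracket R f3 f2 f1 =
  [set hclass R (bracket_map d) | d in [set: data]].
Proof.
apply/seteqP; split=> _ [d _ <-]; first by exists (aqs2_data _ _ _ _ d).
by exists (@Build_aqs2_presentation R _ _ _ _ _ _ _ f3 f2 f1 d
  omega21_equivalence omega31_equivalence (omega32_equivalence d)).
Qed.

(** Through [psi], an extension over the suspended mapping cone is the same thing as a null homotopy
    of the composite, and the two choices in Toda's bracket are exactly the two extensions. *)
Lemma bracket_data_toda :
  [set hclass R (bracket_map d) | d in [set: data]] =
  toda_bracket R m3 f3 f2 (smap R m2 f1).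
Proof.
have [pP1 P1b P1c] := @psi_pointed R m2 _ _ _ pf1.
have [pP2 P2b P2c] := @psi_pointed R m3 _ _ _ pf2.
have [pI1 _ _] := @psi_inv_pointed R m2 _ _ _ pf1.
have [pI2 _ _] := @psi_inv_pointed R m3 _ _ _ pf2.
have psib1 := @psi_cone_base R m2 _ _ _ pf1.
have psib2 := @psi_cone_base R m3 _ _ _ pf2.
have [_ sf1p] := psf1; have [_ sf2p] := psf2.
apply/seteqP; split=> [_ [d _ <-]|_ [A2 [A1 [nA2 nA1 ->]]]].
  have ph := f2bar_map _ _ _ _ d; have hE := f2barE _ _ _ _ d.
  have pk := f3bar_map _ _ _ _ d; have kE := f3barE _ _ _ _ d.
  pose A2 p := f3bar d (psi R m3 f2 (cone_pt R (smap R m3 f2) p.1 p.2)).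
  pose A1 p := f2bar d (psi R m2 f1 (cone_pt R sf1 p.1 p.2)).
  (* Composing a map with the cone lines of a mapping cone gives a null homotopy of its restriction
     to the base composed with [f]; used for both extensions. *)
  have null (U V W S : ptopologicalType) (f : U -> V) (h : W -> S)
      (p : mapcone R f -> W) (q : V -> S) : pointed_map f -> pointed_map h ->
      pointed_map p -> (forall y, h (p (cone_base R f y)) = q y) ->
      null_homotopy R (q \o f) (fun v => h (p (cone_pt R f v.1 v.2))).
    move=> [_ fp] [ch hp] [cp pp] hq; split=> [|u|u|t] /=.
    - by apply: (continuous_comp_fun ch); apply: (continuous_comp_fun cp); cts.
    - by rewrite cone_pt0 hq.
    - by rewrite cone_pt1 // pp hp.
    - by rewrite cone_pt_pointl // pp hp.
  have nA2 : null_homotopy R (f3 \o smap R m3 f2) A2.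
    apply: (null _ _ _ _ _ _ _ _ psf2 pk pP2) => y.
    by rewrite psib2; exact: (congr1 (fun F => F y) kE).
  have nA1 : null_homotopy R (f2 \o sf1) A1.
    apply: (null _ _ _ _ _ _ _ _ psf1 ph pP1) => y.
    by rewrite psib1; exact: (congr1 (fun F => F y) hE).
  exists A2, A1; split=> //.
  rewrite -(bracket_map_toda ph hE pk kE nA2 nA1) //.
  by apply: hclass_eq; exact: bracket_map_canonical.
have rec (U V W : ptopologicalType) (f : U -> V) (q : V -> W) A : pointed_map q ->
    null_homotopy R (q \o f) A ->
    [/\ pointed_map (extension R q A f),
      (forall y, extension R q A f (cone_base R f y) = q y) &
      (forall x t, extension R q A f (cone_pt R f x t) = A (x, t))].
  move=> [cq qp] [cA A0 A1' Ap]; apply: mapcone_rec_pointed => //.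
  by apply: (continuous_comp_fun cA); cts.
have [pe1 e1b e1c] := rec _ _ _ _ _ _ pf2 nA1.
have [pe2 e2b e2c] := rec _ _ _ _ _ _ pf3 nA2.
(* Conversely, a null homotopy extends the map over the mapping cone of the suspension, and
   [psi_inv] moves the extension to the suspension of the mapping cone. *)
pose h := extension R f2 A1 sf1 \o @psi_inv R m2 _ _ f1.
pose k := extension R f3 A2 (smap R m3 f2) \o @psi_inv R m3 _ _ f2.
have ph : pointed_map h by exact: pointed_comp.
have pk : pointed_map k by exact: pointed_comp.
have hE : h \o sj21 = f2.
  apply/funext => y; rewrite /h /= -[RHS]e1b; congr (extension _ _ _ _ _).
  exact: (@psi_inv_cone_base R m2 _ _ _ pf1).
have kE : k \o smap R m3 (j31 R f2) = f3.
  apply/funext => y; rewrite /k /= -[RHS]e2b; congr (extension _ _ _ _ _).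
  exact: (@psi_inv_cone_base R m3 _ _ _ pf2).
exists (with_susp_omega_inv ph hE pk kE) => //.
rewrite (bracket_map_toda ph hE pk kE nA2 nA1) //.
  by move=> u t; rewrite /k /= psiK.
by move=> x t; rewrite /h /= psiK.
Qed.
End Brackets.

Theorem theorem7p1 (R : realType) (X1 X2 X3 X4 : ptopologicalType)
    (m1 m2 m3 : nat) (f1 : susp R m1 X1 -> X2) (f2 : susp R m2 X2 -> X3)
    (f3 : susp R m3 X3 -> X4) :
  well_pointed R X1 -> well_pointed R X2 ->
  well_pointed R X3 -> well_pointed R X4 ->
  pointed_map f1 -> pointed_map f2 -> pointed_map f3 ->
  st_bracket R f3 f2 f1 = aqs2_bracket R f3 f2 f1 /\
  aqs2_bracket R f3 f2 f1 = toda_bracket R m3 f3 f2 (smap R m2 f1).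
Proof.
move=> _ _ _ _ pf1 pf2 pf3.
by rewrite st_bracket_eq // aqs2_bracket_eq // bracket_data_toda.
Qed.
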